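(* For any group $G$, the set $LO(G)$ is either finite or uncountable.
   Context: $LO(G)$ is the set of all positive cones of left orderings of $G$, i.e. subsets $P \subset G$ with $P\cdot P \subset P$ and $P \sqcup P^{-1} \sqcup \{1\} = G$ (disjoint union). Positive cones correspond bijectively to strict total orderings $<$ of $G$ satisfying $g<h \Rightarrow fg<fh$ for all $f,g,h \in G$, via $P=\{g\in G : g>1\}$. *)

(* Defs.v *)
From mathcomp Require Import all_boot.
From mathcomp Require Import boolp classical_sets functions cardinality.

Set Implicit Arguments.
Unset Strict Implicit.
Unset Printing Implicit Defensive.

Local Open Scope classical_set_scope.
Local Open Scope group_scope.

(* [groupType] is the (possibly infinite) group structure of
   [mathcomp.boot.monoid].  Its choiceType component is no restriction on the
   group: under the classical axioms of [boolp], [gen_eqMixin] and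
   [gen_choiceMixin] provide it on any type. *)

Definition set_mulg (G : groupType) (A B : set G) : set G :=
  [set a * b | a in A & b in B].

Definition set_invg (G : groupType) (A : set G) : set G :=
  [set a^-1 | a in A].

Definition positive_cone (G : groupType) (P : set G) : Prop :=
  [/\ set_mulg P P `<=` P,
      P `|` set_invg P `|` [set 1] = [set: G],
      P `&` set_invg P = set0,
      P `&` [set 1] = set0
    & set_invg P `&` [set 1] = set0].

Definition LO (G : groupType) : set (set G) := [set P | positive_cone P].
Arguments LO G : clear implicits.

(* Main.v *)
Require Import Defs.
From mathcomp Require Import all_boot.
From mathcomp Require Import boolp classical_sets functions cardinality.
From mathcomp Require Import filter.

(** Suppose that a group [G] has countably many, and at least one, positive
    cones.  It has to be shown that there are finitely many.

    The set of cones is compact, so if countable it has an isolated point in each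
    of its nonempty subsets ([countable_rcone_isolated]), and likewise for the
    orders on quotients of convex subgroups, which embed into it
    ([countable_rcone]).  Consider a minimal closed set of cones invariant under
    conjugation.  It has an isolated point [P], to which minimality makes all its
    points conjugate; by compactness every element of [G] has a nontrivial power
    whose conjugation preserves [P] ([countable_LO_recurrent]).

    The order of [P] has finitely many convex subgroups, since the signs on
    different convex jumps can be changed independently ([finite_hulls]).
    Recurrence gives the jumps the structure known for Conradian orders: if [D]
    is the largest proper convex subgroup of the convex subgroup [C], then [D] is
    normal in [C] and [C / D] is Archimedean ([jump_normal], [jump_arch]), hence
    abelian by Hoelder ([arch_comm_mod]).  An abelian group of rank at least two
    has no isolated order: an isolated order is generated up to roots by finitely
    many elements, and the larger of two generators is always superfluous.  So
    [C / D] has rank one ([countable_commensurable]) and exactly two orders.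

    It remains to see that [D] is convex in every order of [C]; then an order
    of [C] amounts to an order of [C / D] and an order of [D], and induction
    concludes ([convex_finite]).  Let [E] be the largest proper convex subgroup
    of [D], by induction convex in all orders of [D].  If some element of [C]
    reverses the order of [D / E], a direct estimate proves [D] convex
    ([reversed_convex]).  Otherwise [C] acts on [D / E] by order-preserving maps,
    and [C / E] is either abelian of rank two or a group of affine
    transformations of a line; in the latter case the orders that record how a
    base point and then a second point are moved have no isolated one among them
    ([base_cone_not_isolated]).  Both contradict countability
    ([positive_uncountable]). *)

Set Implicit Arguments.
Unset Strict Implicit.
Unset Printing Implicit Defensive.

Local Open Scope classical_set_scope.
Local Open Scope group_scope.

(* Normal forms of words in a free group, powers being treated as letters. *)
Ltac gsimp := rewrite ?(invgM, invgK, mulgA, mulgK, mulgVK, mulgV, mulVg,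
                        mul1g, mulg1, invg1).

(** * Relative cones *)

Section RelativeCones.
Context {G : groupType}.
Implicit Types (C D E H P Q R T U : set G) (x y z c d g h : G) (F : seq G).

Record subgroup H : Prop := Subgroup {
  sg1 : H 1;
  sgM : forall x y, H x -> H y -> H (x * y);
  sgV : forall x, H x -> H x^-1 }.

(** Left-invariant strict total orders on the set of cosets [C / D], encoded by
    the elements of [C] lying above the coset [D].  The relative form makes
    quotients by convex subgroups, normal or not, available without a quotient
    type. *)
Record rcone C D T : Prop := Rcone {
  rcS : forall x, T x -> C x;
  rcM : forall x y, T x -> T y -> T (x * y);
  rc3 : forall x, C x -> [\/ T x, D x | T x^-1];
  rcD : forall x, T x -> ~ D x }.

Lemma sgVE H x : subgroup H -> H x^-1 <-> H x.
Proof. by move=> sH; split=> /(sgV sH) //; rewrite invgK. Qed.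

Lemma sgX H x n : subgroup H -> H x -> H (x ^+ n).
Proof.
move=> sH Hx; elim: n => [|n IH]; first by rewrite expg0; exact: sg1.
by rewrite expgS; exact: sgM.
Qed.

Lemma sgMl H x y : subgroup H -> H x -> H (x * y) <-> H y.
Proof.
move=> sH Hx; split=> [Hxy|]; last exact: sgM.
by rewrite -(mulKg x y); apply: sgM => //; exact: sgV.
Qed.

Lemma sgMr H x y : subgroup H -> H y -> H (x * y) <-> H x.
Proof.
move=> sH Hy; split=> [Hxy|Hx]; last exact: sgM.
by rewrite -(mulgK y x); apply: sgM => //; exact: sgV.
Qed.

Lemma subgroup_conj H c : subgroup H -> subgroup [set x | H (c^-1 * x * c)].
Proof.
move=> sH; split=> /= [|x y Hx Hy|x Hx].
- by gsimp; exact: sg1.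
- by have := sgM sH Hx Hy; gsimp.
- by have := sgV sH Hx; gsimp.
Qed.

Lemma subgroup1 : subgroup [set 1 : G].
Proof. by split=> [|_ _ -> ->|_ ->]; rewrite /= ?mulg1 ?invg1. Qed.

Lemma sub1_subgroup H : subgroup H -> [set 1] `<=` H.
Proof. by move=> sH _ ->; exact: sg1. Qed.

Lemma subgroupT : subgroup [set: G].
Proof. by split. Qed.

Lemma rcVN C D T x : subgroup D -> rcone C D T -> T x -> ~ T x^-1.
Proof.
move=> sD rT Tx Tx'; apply: (rcD rT (rcM rT Tx Tx')).
by rewrite mulgV; exact: sg1.
Qed.

Lemma rcMD C D T x d : subgroup C -> subgroup D -> (forall x, D x -> C x) ->
  rcone C D T -> T x -> D d -> T (x * d).
Proof.
move=> sC sD DC rT Tx Dd.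
have : C (x * d) by apply: sgM => //; [exact: (rcS rT Tx)|exact: DC].
case/(rc3 rT)=> // [/(sgMr x sD Dd) Dx|Tn]; first by case: (rcD rT Tx).
case: (rcD rT (rcM rT Tn Tx)); rewrite invgM mulgVK; exact: (sgV sD Dd).
Qed.

Lemma rcDM C D T x d : subgroup C -> subgroup D -> (forall x, D x -> C x) ->
  rcone C D T -> T x -> D d -> T (d * x).
Proof.
move=> sC sD DC rT Tx Dd.
have : C (d * x) by apply: sgM => //; [exact: DC|exact: (rcS rT Tx)].
case/(rc3 rT)=> // [/(sgMl x sD Dd) Dx|Tn]; first by case: (rcD rT Tx).
case: (rcD rT (rcM rT Tx Tn)); rewrite invgM mulVKg; exact: (sgV sD Dd).
Qed.

Lemma rcX C D T x n : rcone C D T -> T x -> T (x ^+ n.+1).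
Proof.
by move=> rT Tx; elim: n => [|n IH]; rewrite ?expg1 // expgS; exact: (rcM rT Tx IH).
Qed.

(** A left-ordered quotient has no torsion. *)
Lemma rc_root C D T x n : subgroup D -> rcone C D T ->
  C x -> D (x ^+ n.+1) -> D x.
Proof.
move=> sD rT Cx Dx; case: (rc3 rT Cx) => // Tx.
  by case: (rcD rT (rcX n rT Tx)).
by case: (rcD rT (rcX n rT Tx)); rewrite expVgn; exact: (sgV sD Dx).
Qed.

Lemma rcone_eq C D T U : subgroup D -> rcone C D T -> rcone C D U ->
  (forall x, T x -> U x) -> T = U.
Proof.
move=> sD rT rU TU; apply/seteqP; split=> // x Ux.
case: (rc3 rT (rcS rU Ux)) => // [/(rcD rU Ux)//|/TU Ux'].
by case: (rcVN sD rU Ux Ux').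
Qed.

Lemma LO_rcone P : LO G P <-> rcone [set: G] [set 1] P.
Proof.
split=> [[PM PT PI P1 _]|rP].
  split=> // [x y Px Py|x _|x Px x1]; first by apply: PM; exists x => //; exists y.
  - have : [set: G] x by []. 
    rewrite -PT => -[[Px|[y Py <-]]|->]; [exact: Or31| |exact: Or32].
    by apply: Or33; rewrite invgK.
  - by have : (P `&` [set 1]) x by []; rewrite P1.
split.
- by move=> _ [x Px [y Py <-]]; exact: (rcM rP Px Py).
- apply/seteqP; split=> // x _; case: (rc3 rP (I : [set: G] x)) => Px.
  + by left; left.
  + by right.
  + by left; right; exists x^-1 => //; rewrite invgK.
- apply/seteqP; split=> // x [Px [y Py yx]].
  by apply: (rcVN subgroup1 rP Py); rewrite yx.
- by apply/seteqP; split=> // x [/(rcD rP) + x1].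
- apply/seteqP; split=> // x [[y Py <-] y1]; apply: (rcD rP Py).
  by rewrite -(invgK y) y1 /= invg1.
Qed.

(** * Compactness and countable spaces of cones *)

Definition agree F P Q := forall x, x \in F -> P x = Q x.

Lemma agree_sym F P Q : agree F P Q -> agree F Q P.
Proof. by move=> PQ x /PQ. Qed.

Lemma agree_trans F P Q R : agree F P Q -> agree F Q R -> agree F P R.
Proof. by move=> PQ QR x Fx; rewrite PQ ?QR. Qed.

Lemma agree_sub (F F' : seq G) P Q : {subset F <= F'} -> agree F' P Q -> agree F P Q.
Proof. by move=> FF' PQ x /FF' /PQ. Qed.

(** The cone axioms involve finitely many elements at a time, hence pass to the
    limit along a free ultrafilter on the indices. *)
Lemma rcone_cluster C D (T : nat -> set G) : subgroup D ->
  (forall n, rcone C D (T n)) ->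
  exists2 R, rcone C D R &
    forall F N, exists n, (N <= n)%N /\ agree F (T n) R.
Proof.
move=> sD rT.
have [U [UU subU]] := ultraFilterLemma (eventually_filter).
pose R : set G := [set x | U [set n | T n x]].
have RN x : ~ R x -> U [set n | ~ T n x].
  by move=> nRx; case: (in_ultra_setVsetC [set n | T n x] UU).
exists R.
  split.
  - move=> x /filter_ex [n]; exact: rcS.
  - move=> x y Rx Ry; apply: filterS2 Rx Ry => n; exact: rcM.
  - move=> x Cx; have [|nRx] := pselect (R x); first exact: Or31.
    have [|nDx] := pselect (D x); first exact: Or32.
    apply: Or33; apply: filterS (RN _ nRx) => n /= nTx.
    by case: (rc3 (rT n) Cx).
  - by move=> x /filter_ex [n]; exact: rcD.
move=> F N.
have UF : U [set n | agree F (T n) R].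
  elim: F => [|x F IH]; first by apply: filterE => n x.
  have : U [set n | T n x = R x].
    have [Rx|nRx] := pselect (R x).
      by apply: filterS (Rx) => n /= Tx; apply/propext.
    by apply: filterS (RN _ nRx) => n /= nTx; apply/propext.
  apply: filterS2 IH => n aF e y; rewrite inE => /predU1P[->|Fy] //; exact: aF.
have UN : U [set n | (N <= n)%N] by apply: subU; exists N.
have [n [An Nn]] := filter_ex (filterI UF UN).
by exists n.
Qed.

End RelativeCones.

Section Countability.
Context {G : groupType}.
Implicit Types (C D E H P Q R T U : set G) (x y z c d g h : G) (F : seq G).

Lemma countable_enum (S : set (set G)) : countable S ->
  exists e : nat -> set G, forall T, S T -> exists n, e n = T.
Proof.
case/countable_injP=> f inj_f.
exists (fun n => xget set0 [set T | S T /\ f T = n]) => T ST; exists (f T).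
by case: xgetP => [U _ [SU fUT]|/(_ T)[]//]; apply: inj_f; rewrite ?inE.
Qed.

(** A diagonal argument: enumerate the cones and choose a decreasing sequence in
    [S] whose step [n] avoids the [n]-th cone whenever a member of [S] inside the
    current set does so.  By compactness some cone [T] survives; if [T] is the
    [k]-th one, nothing in [S] inside the [k]-th set avoids it. *)
Lemma countable_rcone_family C D (S : set (set (set G))) :
  subgroup D -> countable [set T | rcone C D T] ->
  (forall Y, S Y -> Y !=set0) ->
  (forall Y T, S Y -> Y T -> rcone C D T) ->
  (forall Y R, S Y -> rcone C D R ->
     (forall F, exists2 T, Y T & agree F T R) -> Y R) ->
  S !=set0 ->
  exists Y T, [/\ S Y, Y T & forall Z, S Z -> Z `<=` Y -> Z T].
Proof.
move=> sD /countable_enum[e enumT] S0 SR Scl [Y0 SY0].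
pose next n Y := if pselect (exists Z, [/\ S Z, Z `<=` Y & ~ Z (e n)]) is left h
                 then projT1 (cid h) else Y.
pose fix Ys n := if n is m.+1 then next m (Ys m) else Y0.
have nextP n Y : S Y -> [/\ S (next n Y), next n Y `<=` Y &
    forall Z, S Z -> Z `<=` Y -> ~ Z (e n) -> ~ next n Y (e n)].
  rewrite /next; case: pselect => [h|nh] SY; last first.
    by split=> // Z SZ ZY nZe; case: nh; exists Z.
  by case: (cid h) => Z /= [].
have SYs n : S (Ys n) by elim: n => // n IH; case: (nextP n _ IH).
have dec m n : (m <= n)%N -> Ys n `<=` Ys m.
  elim: n => [|n IH]; first by rewrite leqn0 => /eqP->.
  rewrite leq_eqVlt => /predU1P[->//|/IH sub].
  by case: (nextP n _ (SYs n)) => _ /= h _; exact: subset_trans h sub.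
have [T TY] : {T : nat -> set G & forall n, Ys n (T n)}.
  by apply: (@boolp.choice _ _ (fun n T => Ys n T)) => n; have [T] := S0 _ (SYs n); exists T.
have rT n : rcone C D (T n) := SR _ _ (SYs n) (TY n).
(* Each set of the sequence is closed and contains all later points. *)
have [R rR clR] := rcone_cluster sD rT.
have RY m : Ys m R.
  apply: Scl => // F; have [n [mn ag]] := clR F m.
  by exists (T n) => //; apply: dec mn _ _.
have [k ek] := enumT R rR.
exists (Ys k), R; split=> // Z SZ ZY.
apply: contrapT => nZR; case: (nextP k _ (SYs k)) => _ _ /(_ Z SZ ZY).
by rewrite ek => /(_ nZR); apply; exact: (RY k.+1).
Qed.

(** Baire category in this setting: apply the diagonal argument to the traces of
    basic neighbourhoods of the points of [X].  The point it returns lies in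
    arbitrarily small neighbourhoods of every point of [X] near [P], hence equals
    all of them. *)
Lemma countable_rcone_isolated C D (X : set (set G)) :
  subgroup D -> countable [set T | rcone C D T] ->
  X `<=` [set T | rcone C D T] -> X !=set0 ->
  exists T F, X T /\ forall T', X T' -> agree F T T' -> T' = T.
Proof.
move=> sD cRC XR [T0 XT0].
pose nb T F := [set T' | rcone C D T' /\ agree F T T'].
pose S := [set Y | exists T F, X T /\ Y = nb T F].
have [||||Y [T [[P [F [XP ->]]] [rT aPT] TZ]]] :=
    @countable_rcone_family C D S sD cRC.
- by move=> Y [T [F [XT ->]]]; exists T; split=> //; exact: XR.
- by move=> Y T [P [F [XP ->]]] [].
- move=> Y R [P [F [XP ->]]] rR /(_ F)[T [_ PT TR]]; split=> //.
  exact: agree_trans TR.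
- by exists (nb T0 [::]), T0, [::].
have TP P' : X P' -> agree F P P' -> T = P'.
  move=> XP' aP'; apply/funext => x.
  have [| |_ ax] := TZ (nb P' (x :: F)).
  - by exists P', (x :: F).
  - move=> Q [rQ aQ]; split=> //; apply: agree_trans aP' _.
    by apply: agree_sub aQ => y Fy; rewrite inE Fy orbT.
  - by rewrite ax // mem_head.
exists P, F; split=> // T' XT' /(TP _ XT') <-.
exact: TP.
Qed.

Definition cone_conj c P : set G := [set x | P (c^-1 * x * c)].

Lemma cone_conjM c d P : cone_conj c (cone_conj d P) = cone_conj (c * d) P.
Proof. by apply/funext => x; rewrite /cone_conj /=; gsimp. Qed.

Lemma cone_conj1 P : cone_conj 1 P = P.
Proof. by apply/funext => x; rewrite /cone_conj /=; gsimp. Qed.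

Lemma cone_conjK c P : cone_conj c^-1 (cone_conj c P) = P.
Proof. by rewrite cone_conjM mulVg cone_conj1. Qed.

Lemma rcone_conj C D c T :
  (forall x, C (c^-1 * x * c) <-> C x) -> (forall x, D (c^-1 * x * c) <-> D x) ->
  rcone C D T -> rcone C D (cone_conj c T).
Proof.
move=> cC cD rT; split=> [x /(rcS rT)/cC//|x y Tx Ty|x /cC/(rc3 rT)|x /(rcD rT) + Dx].
- by have := rcM rT Tx Ty; rewrite /cone_conj /=; gsimp.
- case=> [Tx|/cD Dx|Tx]; [exact: Or31|exact: Or32|apply: Or33].
  by move: Tx; rewrite /cone_conj /=; gsimp.
- by apply; apply/cD.
Qed.

Lemma LO_conj c P : LO G P -> LO G (cone_conj c P).
Proof.
move=> /LO_rcone rP; apply/LO_rcone; apply: rcone_conj rP => // x.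
split=> /= [|->]; last by gsimp.
by move/(congr1 (fun y => c * y * c^-1)); gsimp.
Qed.

Lemma agree_conj F c P Q :
  agree [seq c * x * c^-1 | x <- F] P Q -> agree F (cone_conj c^-1 P) (cone_conj c^-1 Q).
Proof.
by move=> a x Fx; rewrite /cone_conj /= invgK a //; apply: map_f.
Qed.

Definition orbit_closure P : set (set G) :=
  [set R | LO G R /\ forall F, exists c, agree F (cone_conj c P) R].

Lemma orbit_closure_trans P Q :
  orbit_closure P Q -> orbit_closure Q `<=` orbit_closure P.
Proof.
move=> [_ PQ] R [LR QR]; split=> // F; have [c cQR] := QR F.
have [d dPQ] := PQ [seq c^-1 * x * c^-1^-1 | x <- F].
exists (c * d); rewrite -cone_conjM; apply: agree_trans cQR.
by have := agree_conj dPQ; rewrite invgK.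
Qed.

Lemma orbit_closure_refl c P : LO G P -> orbit_closure P (cone_conj c P).
Proof. by move=> LP; split; [exact: LO_conj|move=> F; exists c]. Qed.

(** The orbit closure of [T] is a minimal closed set invariant under
    conjugation; countability replaces Zorn's lemma. *)
Lemma countable_LO_minimal : countable (LO G) -> LO G !=set0 ->
  exists2 T, LO G T & forall Q, orbit_closure T Q -> orbit_closure Q T.
Proof.
move=> cLO [P0 LP0].
have eLO : LO G = [set T | rcone [set: G] [set 1] T].
  by apply/funext => T; apply/propext; exact: LO_rcone.
pose S := [set Y | exists2 P, LO G P & Y = orbit_closure P].
rewrite eLO in cLO.
have [||||Y [T [[P LP ->] PT TZ]]] :=
    @countable_rcone_family [set: G] [set 1] S subgroup1 cLO.
- by move=> Y [P LP ->]; exists P; rewrite -{2}(cone_conj1 P); exact: orbit_closure_refl.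
- by move=> Y T [P LP ->] [/LO_rcone].
- move=> Y R [P LP ->] rR RF; split=> [|F]; first exact/LO_rcone.
  have [T [_ /(_ F)[c PT]] TR] := RF F; exists c; exact: agree_trans TR.
- by exists (orbit_closure P0), P0.
exists T => [|Q TQ]; first by case: PT.
have PQ := orbit_closure_trans PT TQ.
apply: TZ; last exact: orbit_closure_trans.
by exists Q => //; case: PQ.
Qed.

(** Let [P] be isolated in its orbit, with minimal orbit closure.  A cluster point
    of the conjugates of [P] by the powers of [g] has by minimality a conjugate
    near [P].  So one and the same element carries infinitely many of those
    conjugates near [P], hence to [P] itself, and two of them coincide. *)
Lemma countable_LO_recurrent : countable (LO G) -> LO G !=set0 ->
  exists2 P, LO G P & forall g, exists n, cone_conj (g ^+ n.+1) P = P.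
Proof.
move=> cLO LO0; have [T LT minT] := countable_LO_minimal cLO LO0.
have eLO : LO G = [set T | rcone [set: G] [set 1] T].
  by apply/funext => U; apply/propext; exact: LO_rcone.
have [|||_ [F [[c _ <-] isoP]]] :=
  @countable_rcone_isolated [set: G] [set 1] [set cone_conj c T | c in [set: G]] subgroup1.
- by rewrite -eLO.
- by move=> _ [c _ <-]; apply/LO_rcone; exact: LO_conj.
- by exists T; exists 1 => //; exact: cone_conj1.
pose P := cone_conj c T; rewrite -/P in isoP.
have LP : LO G P by exact: LO_conj.
exists P => // g.
have rPn n : rcone [set: G] [set 1] (cone_conj (g ^+ n) P).
  by apply/LO_rcone; exact: LO_conj.
have [Q rQ clQ] := rcone_cluster subgroup1 rPn.
have TQ : orbit_closure T Q.
  split=> [|F']; first exact/LO_rcone.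
  by have [n [_ a]] := clQ F' 0; exists (g ^+ n * c); rewrite -cone_conjM.
have QP : orbit_closure Q P.
  by apply: orbit_closure_trans (minT _ TQ) _ _; exact: orbit_closure_refl.
have [_ /(_ F)[d dQP]] := QP.
have fixn N : exists2 n, (N <= n)%N & cone_conj (d * g ^+ n) P = P.
  have [n [Nn a]] := clQ [seq d^-1 * x * d^-1^-1 | x <- F] N.
  exists n => //; apply: isoP; first by exists (d * g ^+ n * c); rewrite -?cone_conjM.
  apply: agree_sym; apply: agree_trans dQP.
  by have := agree_conj a; rewrite invgK cone_conjM.
have [m _ em] := fixn 0; have [n mn en] := fixn m.+1.
exists (n - m.+1)%N.
have : cone_conj (d * g ^+ m) (cone_conj (g ^+ (n - m.+1).+1) P) = P.
  by rewrite cone_conjM -mulgA -expgnDr -subSn // subSS subnKC // ltnW.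
by rewrite -{2}em => /(congr1 (cone_conj (d * g ^+ m)^-1)); rewrite !cone_conjK.
Qed.

End Countability.

(** * Convex subgroups *)

Section Convexity.
Context {G : groupType}.
Implicit Types (C D E H K P Q R T U : set G) (x y z c d g h : G) (F : seq G).

(** Convexity of the subgroup [H], stated as domination: a positive element
    outside [H] stays positive after multiplication by any element of [H]. *)
Definition convex P H := forall x y, P x -> ~ H x -> H y -> P (y * x).

Lemma rcone_up C E H Q : subgroup C -> subgroup E -> subgroup H ->
  E `<=` H -> H `<=` C -> rcone C E Q -> convex Q H -> rcone C H (Q `\` H).
Proof.
move=> sC sE sH EH HC rQ cQH; split.
- by move=> x [/(rcS rQ)].
- move=> x y [Qx nHx] [Qy nHy]; split; first exact: (rcM rQ).
  move=> Hxy; apply: (rcVN sE rQ Qy).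
  by have := cQH _ _ Qx nHx (sgV sH Hxy); gsimp.
- move=> x Cx; have [|nHx] := pselect (H x); first exact: Or32.
  case: (rc3 rQ Cx) => [Qx|/EH//|Qx]; [exact: Or31|apply: Or33; split=> //].
  by move/(sgVE _ sH).
- by move=> x [].
Qed.

Lemma rcone_down C E H Q : subgroup H -> H `<=` C -> rcone C E Q ->
  rcone H E (Q `&` H).
Proof.
move=> sH HC rQ; split.
- by move=> x [].
- by move=> x y [Qx Hx] [Qy Hy]; split; [exact: (rcM rQ)|exact: (sgM sH)].
- move=> x Hx; case: (rc3 rQ (HC _ Hx)) => Qx; [exact: Or31|exact: Or32|].
  by apply: Or33; split=> //; exact: (sgV sH).
- by move=> x [/(rcD rQ)].
Qed.

(** Lexicographic product of an order on [C / D] and an order on [D / E]. *)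
Lemma rcone_glue C D E T U : subgroup C -> subgroup D -> D `<=` C -> E `<=` D ->
  rcone C D T -> rcone D E U -> rcone C E (T `|` U).
Proof.
move=> sC sD DC ED rT rU; split.
- by move=> x [/(rcS rT)//|/(rcS rU)/DC].
- move=> x y [Tx|Ux] [Ty|Uy].
  + by left; exact: (rcM rT).
  + by left; apply: (rcMD sC sD DC rT) => //; exact: (rcS rU).
  + by left; apply: (rcDM sC sD DC rT) => //; exact: (rcS rU).
  + by right; exact: (rcM rU).
- move=> x /(rc3 rT)[Tx|/(rc3 rU)[Ux|Ex|Ux]|Tx].
  + by apply: Or31; left.
  + by apply: Or31; right.
  + exact: Or32.
  + by apply: Or33; right.
  + by apply: Or33; left.
- by move=> x [/(rcD rT) + /ED|/(rcD rU)].
Qed.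

(** If positive [h] and [k] were outside the other subgroup, domination would
    make both [h^-1 * k] and its inverse positive. *)
Lemma convex_total C E P H K : subgroup E -> rcone C E P ->
  subgroup H -> subgroup K -> E `<=` H -> E `<=` K -> H `<=` C -> K `<=` C ->
  convex P H -> convex P K -> H `<=` K \/ K `<=` H.
Proof.
move=> sE rP sH sK EH EK HC KC cH cK.
have [|nHK] := pselect (H `<=` K); [by left|right=> k Kk].
apply: contrapT => nHk; apply: nHK => h Hh; apply: contrapT => nKh.
have pos L M z : subgroup L -> subgroup M -> E `<=` M -> L z -> ~ M z -> C z ->
    exists z', [/\ L z', ~ M z' & P z'].
  move=> sL sM EM Lz nMz Cz; case: (rc3 rP Cz) => [Pz|/EM//|Pz].
    by exists z.
  by exists z^-1; split=> //; [exact: (sgV sL)|move/(sgVE _ sM)].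
have [h' [Hh' nKh' Ph']] := pos H K h sH sK EK Hh nKh (HC _ Hh).
have [k' [Kk' nHk' Pk']] := pos K H k sK sH EH Kk nHk (KC _ Kk).
have P1 := cH _ _ Pk' nHk' (sgV sH Hh').
have P2 := cK _ _ Ph' nKh' (sgV sK Kk').
by apply: (rcVN sE rP P1); move: P2; gsimp.
Qed.

(** Splice any order on [C / D] between the parts of [P] outside [C] and
    inside [D]. *)
Lemma countable_rcone C D P : countable (LO G) -> LO G P ->
  subgroup C -> subgroup D -> D `<=` C -> convex P C -> convex P D ->
  countable [set T | rcone C D T].
Proof.
move=> /countable_injP[f inj_f] /LO_rcone rP sC sD DC cC cD.
have D1 := sub1_subgroup sD; have C1 := sub1_subgroup sC.
have rU := rcone_up subgroupT subgroup1 sC C1 (@subsetT _ _) rP cC.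
have rL := rcone_down sD (@subsetT _ _) rP.
pose ext T := (P `\` C) `|` (T `|` (P `&` D)).
have extLO T : rcone C D T -> LO G (ext T).
  move=> rT; apply/LO_rcone.
  exact: (rcone_glue subgroupT sC (@subsetT _ _) C1 rU (rcone_glue sC sD DC D1 rT rL)).
have extE T : rcone C D T -> T = ext T `&` (C `\` D).
  move=> rT; apply/seteqP; split=> x.
    move=> Tx; have Cx := rcS rT Tx; have Dx := rcD rT Tx.
    by split=> //; right; left.
  by case=> -[[_ nC]|[//|[_ Dx]]] [].
apply/countable_injP; exists (f \o ext) => T U; rewrite !inE => rT rU' /= eTU.
by rewrite (extE T) // (extE U) //; congr (_ `&` _); apply: inj_f; rewrite ?inE //; exact: extLO.
Qed.

(** * Finiteness of the set of principal convex subgroups *)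

(** The convex subgroup generated by [g]. *)
Definition hull P g : set G :=
  [set x | forall H, subgroup H -> convex P H -> H g -> H x].

Lemma hull_id P g : hull P g g. Proof. by []. Qed.
Arguments hull_id : clear implicits.

Lemma hull_subgroup P g : subgroup (hull P g).
Proof.
split=> [H sH _ _|x y hx hy H sH cH Hg|x hx H sH cH Hg]; first exact: sg1.
  by apply: (sgM sH); [exact: hx|exact: hy].
by apply: (sgV sH); exact: hx.
Qed.

Lemma hull_convex P g : convex P (hull P g).
Proof.
move=> x y Px nx hy.
have [H [sH cH Hg nHx]] : exists H, [/\ subgroup H, convex P H, H g & ~ H x].
  apply: contrapT => nex; apply: nx => H sH cH Hg.
  by apply: contrapT => nHx; apply: nex; exists H.
exact: (cH _ _ Px nHx (hy H sH cH Hg)).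
Qed.

Lemma hull_sub P x y : hull P y x -> hull P x `<=` hull P y.
Proof. by move=> hx z hz H sH cH Hy; apply: hz => //; exact: hx. Qed.

Lemma hull_eq P x y : hull P y x -> hull P x y -> hull P x = hull P y.
Proof. by move=> xy yx; apply/seteqP; split; exact: hull_sub. Qed.

Lemma hullV P x : hull P x^-1 = hull P x.
Proof.
apply: hull_eq; first exact: (sgV (hull_subgroup P x) (hull_id P x)).
by rewrite -{2}(invgK x); exact: (sgV (hull_subgroup P _) (hull_id P _)).
Qed.

Arguments hullV : clear implicits.

Section Flip.
Variables (P : set G) (LP : LO G P).
Let rP : rcone [set: G] [set 1] P. Proof. exact/LO_rcone. Qed.

Let PVN x : P x -> ~ P x^-1. Proof. exact: rcVN subgroup1 rP. Qed.

Lemma hull_total x y : hull P x y \/ hull P y x.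
Proof.
have one z : [set 1] `<=` hull P z by move=> _ ->; exact: (sg1 (hull_subgroup P z)).
case: (convex_total subgroup1 rP (hull_subgroup P x) (hull_subgroup P y) (one x)
  (one y) (@subsetT _ _) (@subsetT _ _) (@hull_convex P x) (@hull_convex P y)) => h.
- by right; exact: (h _ (hull_id P x)).
- by left; exact: (h _ (hull_id P y)).
Qed.

Let rhull y : rcone [set: G] (hull P y) (P `\` hull P y).
Proof.
apply: (rcone_up subgroupT subgroup1) => //; [exact: hull_subgroup| |exact: hull_convex].
by move=> _ ->; exact: (sg1 (hull_subgroup P y)).
Qed.

Let domr x y : P x -> ~ hull P y x -> P (x * y).
Proof.
move=> Px nx.
by have [] := rcMD subgroupT (hull_subgroup P y) (fun _ _ => I) (rhull y) (conj Px nx) (hull_id P y).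
Qed.

Lemma hull_mul_lt x y : ~ hull P y x -> hull P (x * y) = hull P x.
Proof.
move=> nx; have hy : hull P x y by case: (hull_total x y).
apply: hull_eq; first exact: (sgM (hull_subgroup P x)).
have sxy := hull_subgroup P (x * y).
case: (hull_total (x * y) y) => h.
  by move: (hull_id P (x * y)) => /(sgMr _ sxy h).
by case: nx; apply/(sgMr x (hull_subgroup P y) (hull_id P y)).
Qed.

Lemma hull_mul_pos x y : P x -> P y -> hull P x y -> hull P (x * y) = hull P x.
Proof.
move=> Px Py hy; apply: hull_eq; first exact: (sgM (hull_subgroup P x)).
move=> H sH cH Hxy; apply: contrapT => nHx; apply: (PVN Py).
by have := cH _ _ Px nHx (sgV sH Hxy); gsimp.
Qed.

Definition flip (A : set (set G)) : set G :=
  [set x | (P x /\ ~ A (hull P x)) \/ (P x^-1 /\ A (hull P x))].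

(** When two elements have distinct hulls, their product has the sign and the
    hull of the factor with the larger hull; when the hulls agree, elements of
    the same sign have a product with that hull.  So signs may be changed hull by
    hull. *)
Lemma LO_flip A : LO G (flip A).
Proof.
pose sg x z := (P x /\ P z) \/ (P x^-1 /\ P z^-1).
have sgE x z : sg x z -> hull P z = hull P x -> flip A x -> flip A z.
  rewrite /flip /= => s ->.
  case: s => -[Px Pz] [[Px' nA]|[Px' nA]]; try by [left|right].
  + by case: (PVN Px).
  + by case: (PVN Px').
apply/LO_rcone; split=> //.
- move=> x y fx fy.
  have [hx|nhx] := pselect (hull P y x); last first.
    apply: sgE (hull_mul_lt nhx) (fx).
    case: fx => -[Px _]; [left|right]; split=> //; first exact: domr.
    rewrite invgM; apply: (@hull_convex P y) => //.
      by move/(sgVE _ (hull_subgroup P y)).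
    exact: (sgV (hull_subgroup P y) (hull_id P y)).
  have [hy|nhy] := pselect (hull P x y); last first.
    apply: (sgE y); last exact: fy.
      case: fy => -[Py _]; [left|right]; split=> //.
        by apply: (@hull_convex P x).
      rewrite invgM; apply: domr => //; rewrite hullV.
      by move/(sgVE _ (hull_subgroup P x)).
    rewrite -(hullV P (x * y)) invgM -(hullV P y) hull_mul_lt //.
    by rewrite hullV => /(sgVE _ (hull_subgroup P x)).
  have exy := hull_eq hx hy.
  case: (fx) (fy) => -[Px Ax] [] [Py Ay]; rewrite ?exy // in Ax.
  + apply: sgE (hull_mul_pos Px Py hy) fx; left; split=> //; exact: (rcM rP).
  + have Pyx : P (x * y)^-1 by rewrite invgM; exact: (rcM rP).
    apply: (sgE x) => //; first by right.
    rewrite -(hullV P (x * y)) invgM hull_mul_pos ?hullV //.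
    exact: (sgV (hull_subgroup P y)).
- move=> x /(rc3 rP)[Px|->|Px]; [|exact: Or32|];
    have [Ax|nAx] := pselect (A (hull P x)).
  + by apply: Or33; right; rewrite hullV invgK.
  + by apply: Or31; left.
  + by apply: Or31; right.
  + by apply: Or33; left; rewrite hullV.
- move=> x [[Px _] x1|[Px _] x1]; apply: (rcD rP Px) => //.
  by rewrite x1 /= invg1.
Qed.

(** Otherwise independent flips embed the subsets of [nat] into the set of
    positive cones, which Cantor's diagonal excludes. *)
Lemma finite_hulls : countable (LO G) -> finite_set [set hull P g | g in [set~ 1]].
Proof.
move=> /countable_enum[e enumLO].
apply: contrapT => /infiniteP/pcard_leP[f].
have [g gP] : {g : nat -> G & forall n, g n <> 1 /\ hull P (g n) = f n}.
  apply: (@boolp.choice _ _ (fun n y => y <> 1 /\ hull P y = f n)) => n.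
  by have [y ny1 ey] := @funS _ _ _ _ f n I; exists y.
have inj_hull m n : hull P (g m) = hull P (g n) -> m = n.
  by rewrite (gP m).2 (gP n).2; apply: inj; rewrite inE.
(* Flip at the hull of [g n] exactly when [e n] and [P] agree on [g n]. *)
pose A K := exists n, K = hull P (g n) /\ (e n (g n) <-> P (g n)).
have [n en] := enumLO _ (LO_flip A).
have AE : A (hull P (g n)) <-> (e n (g n) <-> P (g n)).
  by split=> [[m [/inj_hull<-]]//|h]; exists n.
have : e n (g n) <-> flip A (g n) by rewrite en.
have gn1 : g n <> 1 := (gP n).1.
have PV : P (g n)^-1 <-> ~ P (g n).
  split=> [Pg Pg'|nP]; first exact: PVN Pg' Pg.
  by case: (rc3 rP (I : [set: G] (g n))).
rewrite /flip /= PV; tauto.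
Qed.

End Flip.
End Convexity.

Arguments hull_id {G} P g _ _ _ _.
Arguments hullV {G} P x.

(** * Archimedean quotients are abelian *)

Section Hoelder.
Context {G : groupType}.
Implicit Types (C D E H K P Q R T U : set G) (x y z c d g h : G) (F : seq G).

Definition normal_in C D := forall c d, C c -> D d -> D (c * d * c^-1).

(** For [D] contained in [C]: [D] is normal in [C] with abelian quotient. *)
Definition comm_mod C D := forall a b, C a -> C b -> D (a * b * a^-1 * b^-1).

Section Archimedean.
Variables (C D T : set G).
Hypotheses (sC : subgroup C) (sD : subgroup D) (DC : D `<=` C)
  (nD : normal_in C D) (rT : rcone C D T)
  (arch : forall x y, T x -> C y -> exists n, T (y^-1 * x ^+ n)).

Let W x := T x \/ D x.
Let TC x : T x -> C x. Proof. exact: (rcS rT). Qed.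
Let XC x n : C x -> C (x ^+ n). Proof. exact: sgX. Qed.

(** If [x], the conjugate of [g] by [f], were negative, then some power of [g]
    would be so large that [f * g ^+ n] and its inverse are both positive. *)
Lemma arch_conj g f : T g -> C f -> T (f * g * f^-1).
Proof.
move=> Tg Cf; set x := f * g * f^-1.
have Cx : C x by apply: (sgM sC) (sgV sC Cf); apply: (sgM sC) => //; exact: TC.
case: (rc3 rT Cx) => // [Dx|Tx].
  by case: (rcD rT Tg); have := nD (sgV sC Cf) Dx; rewrite /x; gsimp.
have xX k : x ^+ k = f * g ^+ k * f^-1.
  by elim: k => [|k IH]; rewrite ?expg0 ?expgS ?IH /x; gsimp.
have [n An] := arch Tx Cf; have [m Bm] := arch Tg (sgV sC Cf).
have A k : T (f^-1 * x ^- (n + k)).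
  elim: k => [|k IH]; first by rewrite addn0 -expVgn.
  by have := rcM rT IH Tx; rewrite addnS expgS; gsimp.
have B k : T (f * g ^+ (m + k)).
  elim: k => [|k IH]; first by move: Bm; rewrite invgK addn0.
  by have := rcM rT IH Tg; rewrite addnS expgSr; gsimp.
have := rcM rT (A m) (B n); rewrite addnC xX; gsimp => T1.
by case: (rcD rT T1); exact: sg1.
Qed.

Let W_conj w f : W w -> C f -> W (f * w * f^-1).
Proof. by case=> [Tw|Dw] Cf; [left; exact: arch_conj|right; exact: nD]. Qed.

Let MWT w t : W w -> T t -> T (w * t).
Proof. by case=> [Tw|Dw] Tt; [exact: (rcM rT)|exact: (rcDM sC sD DC rT)]. Qed.

Let MWW w t : W w -> W t -> W (w * t).
Proof.
move=> Ww [Tt|Dt]; first by left; exact: MWT.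
by case: Ww => [Tw|Dw]; [left; exact: (rcMD sC sD DC rT)|right; exact: (sgM sD)].
Qed.

Let WVN w : W w -> ~ T w^-1.
Proof.
case=> [Tw|Dw Tw]; first exact: (rcVN sD rT Tw).
by apply: (rcD rT Tw); exact: (sgV sD).
Qed.

Lemma arch_floor x a : T x -> T a ->
  exists m, W (x ^- m * a) /\ T (a^-1 * x ^+ m.+1).
Proof.
move=> Tx Ta; have [n] := arch Tx (TC Ta).
elim: n => [|n IH] Tn.
  by case: (rcVN sD rT Ta); move: Tn; rewrite expg0 mulg1.
have [/IH//|nT] := pselect (T (a^-1 * x ^+ n)).
exists n; split=> //.
have Cy : C (a^-1 * x ^+ n) by apply: (sgM sC); [exact: (sgV sC (TC Ta))|exact: XC (TC Tx)].
case: (rc3 rT Cy) => // [Dy|]; last by left; move: p; gsimp.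
by right; have := sgV sD Dy; gsimp.
Qed.

Let comm_multiples m n x u v : C x -> D u -> D v ->
  D (x ^+ m * u * (x ^+ n * v) * (x ^+ m * u)^-1 * (x ^+ n * v)^-1).
Proof.
move=> Cx Du Dv.
have D1 : D ((x ^+ n)^-1 * u * (x ^+ n)^-1^-1 * v * u^-1).
  apply: (sgM sD) (sgV sD Du); apply: (sgM sD) Dv.
  by apply: nD Du; exact: (sgV sC (XC _ Cx)).
have := nD (XC n Cx) (sgM sD (nD (XC m Cx) D1) (sgV sD Dv)).
congr (D _); gsimp.
rewrite (_ : x ^+ n * x ^+ m = x ^+ m * x ^+ n); last exact: commuteX2.
by gsimp.
Qed.

(** Hoelder's argument.  Round [a] and [b] down to powers of a small positive
    [x]: the commutator [c] of [a] and [b] is then less than [x ^+ 2].  Either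
    some [x] satisfies [x ^+ 2 <= c], or [c] is the least positive element and
    rounding with [x = c] is exact, so that [a] and [b] commute. *)
Let no_pos_comm a b : T a -> T b -> ~ T (a * b * a^-1 * b^-1).
Proof.
move=> Ta Tb; set c := a * b * a^-1 * b^-1 => Tc.
have [[x Tx xc]|min_c] : (exists2 x, T x & W (x^-1 * x^-1 * c)) \/
    (forall y, T y -> ~ T (y^-1 * c)).
- have [[y [Ty Tw]]|ny] := pselect (exists y, T y /\ T (y^-1 * c)); last first.
    by right=> y Ty Tw; apply: ny; exists y.
  (* [c = y * w], so the square of the smaller of [y] and [w] is at most [c]. *)
  left; set w := y^-1 * c in Tw *.
  have Cyw : C (y^-1 * w) by apply: (sgM sC); [exact: (sgV sC (TC Ty))|exact: TC].
  case: (rc3 rT Cyw) => [Tyw|Dyw|Twy].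
  + by exists y => //; left; move: Tyw; rewrite /w; gsimp.
  + by exists y => //; right; move: Dyw; rewrite /w; gsimp.
  + exists w => //; left; have := arch_conj Twy (sgV sC (TC Tw)).
    by rewrite (_ : c = y * w) /w; gsimp.
- have [m [Wu Tu']] := arch_floor Tx Ta; have [n [Wv Tv']] := arch_floor Tx Tb.
  set u := x ^- m * a in Wu; set v := x ^- n * b in Wv.
  set u' := _ * _ in Tu'; set v' := _ * _ in Tv'.
  have Cx k := XC k (TC Tx).
  pose z := x ^+ n * x ^+ m * x ^- n.+1.
  have Cnm : C (x ^+ n * x ^+ m) by exact: (sgM sC).
  have Cz : C z by apply: (sgM sC) => //; exact: (sgV sC).
  apply: (WVN xc).
  (* The exponents of [x] cancel, leaving a product of four conjugates. *)
  have -> : (x^-1 * x^-1 * c)^-1 =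
      (x ^+ n * v * x ^- n) * ((x ^+ n * x ^+ m) * u * (x ^+ n * x ^+ m)^-1) *
      ((x ^+ n * x ^+ m) * v' * (x ^+ n * x ^+ m)^-1) * (z * u' * z^-1).
    rewrite /z /u /v /u' /v' /c; gsimp.
    rewrite -(mulgA _ (x ^+ m.+1)) -expgnDr addSn addnS addnC 2!expgS expgnDr.
    by gsimp.
  apply: MWT; last by apply: arch_conj.
  by apply: MWW; [apply: MWW|left; apply: arch_conj]; rewrite //; exact: W_conj.
- have [m [Wu Tu']] := arch_floor Tc Ta; have [n [Wv Tv']] := arch_floor Tc Tb.
  set u := _ * _ in Wu; set v := _ * _ in Wv.
  have Du : D u.
    case: Wu => // /min_c[]; rewrite /u; gsimp.
    by move: Tu'; rewrite expgSr; gsimp.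
  have Dv : D v.
    case: Wv => // /min_c[]; rewrite /v; gsimp.
    by move: Tv'; rewrite expgSr; gsimp.
  apply: (rcD rT Tc); have := comm_multiples m n (TC Tc) Du Dv.
  by rewrite /u /v !mulVKg.
Qed.

Lemma arch_comm_mod : comm_mod C D.
Proof.
have pos a b : T a -> T b -> D (a * b * a^-1 * b^-1).
  move=> Ta Tb.
  have Cc : C (a * b * a^-1 * b^-1).
    by do 3?[apply: (sgM sC)]; rewrite ?(sgVE _ sC); exact: TC.
  case: (rc3 rT Cc) => // [/(no_pos_comm Ta Tb)//|].
  by have := no_pos_comm Tb Ta; gsimp.
have Dl a b : D a -> C b -> D (a * b * a^-1 * b^-1).
  move=> Da Cb; have := sgM sD Da (nD Cb (sgV sD Da)); by gsimp.
have posl a b : T a -> C b -> D (a * b * a^-1 * b^-1).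
  move=> Ta Cb; case: (rc3 rT Cb) => [Tb|Db|Tb]; first exact: pos.
    by have := sgV sD (Dl _ _ Db (TC Ta)); gsimp.
  by have := nD Cb (sgV sD (pos _ _ Ta Tb)); gsimp.
move=> a b Ca Cb; case: (rc3 rT Ca) => [Ta|Da|Ta]; [exact: posl|exact: Dl|].
by have := nD Ca (sgV sD (posl _ _ Ta Cb)); gsimp.
Qed.

End Archimedean.
End Hoelder.

(** * Orders preserved by powers of every element *)

Section Recurrent.
Context {G : groupType}.
Implicit Types (C D E H K P Q R T U : set G) (x y z c d g h : G) (F : seq G).

Definition recurrent P := forall g, exists n, cone_conj (g ^+ n.+1) P = P.

Lemma cone_conjP c P x : cone_conj c P = P -> P x -> P (c * x * c^-1).
Proof. by move=> e Px; rewrite -e /cone_conj /=; gsimp. Qed.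

Lemma cone_conjVP c P x : cone_conj c P = P -> P x -> P (c^-1 * x * c).
Proof. by move=> e Px; have : cone_conj c P x by rewrite e. Qed.

Lemma cone_conjX c P n : cone_conj c P = P -> cone_conj (c ^+ n) P = P.
Proof.
move=> e; elim: n => [|n IH]; first by rewrite expg0 cone_conj1.
by rewrite expgS -cone_conjM IH.
Qed.

Variables (P : set G).
Hypotheses (LP : LO G P) (recP : recurrent P).
Let rP : rcone [set: G] [set 1] P. Proof. exact/LO_rcone. Qed.

(** The elements bounded by powers of [g] on both sides form a convex subgroup.
    For a product [u * v] of bounded elements, conjugate the bound on [v] by a
    power of [g] that preserves the order, then move it across [u]. *)
Lemma hull_bounded g h : P g -> hull P g h -> exists n, P (h^-1 * g ^+ n).
Proof.
move=> Pg.
have mono y n m : (n <= m)%N -> P (y * g ^+ n) -> P (y * g ^+ m).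
  move=> /subnKC <-; elim: (m - n)%N => [|k IH] Py; first by rewrite addn0.
  by rewrite addnS expgSr mulgA; exact: (rcM rP (IH Py)).
pose S := [set x | exists n, P (x^-1 * g ^+ n.+1) /\ P (x * g ^+ n.+1)].
suff hS : hull P g h -> S h by case/hS=> n [Pn _]; exists n.+1.
have [k ek] := recP g.
apply.
- split.
  + by exists 0; rewrite invg1 expg1 mul1g.
  + move=> x y [n [xn xn']] [m [ym ym']].
    pose N := (k.+1 * (n + m).+1)%N.
    have nN : (n < N)%N by rewrite /N mulSn (leq_trans _ (leq_addr _ _)) // ltnS leq_addr.
    have mN : (m < N)%N by rewrite /N mulSn (leq_trans _ (leq_addr _ _)) // ltnS leq_addl.
    have stab : cone_conj (g ^+ N) P = P by rewrite expgnA; exact: cone_conjX.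
    have prod u v : P (u * g ^+ N) -> P (v * g ^+ N) -> P (u * v * g ^+ (N + N)).
      move=> Pu Pv; have := rcM rP Pu (cone_conjVP stab Pv).
      by rewrite expgnDr; gsimp.
    exists (N + N).-1; rewrite prednK ?addn_gt0 ?(leq_trans _ nN) // invgM.
    by split; apply: prod; [exact: mono mN ym|exact: mono nN xn|exact: mono nN xn'|exact: mono mN ym'].
  + by move=> x [n [xn xn']]; exists n; rewrite invgK.
- move=> x y Px nSx [n [yn yn']].
  have : [set: G] (y * x) by [].
  case/(rc3 rP)=> // [yx1|Pyx]; exfalso; apply: nSx.
    exists n; have -> : x = y^-1 by rewrite -(mulKg y x) yx1 mulg1.
    by rewrite invgK.
  exists n; split; first by have := rcM rP Pyx yn'; gsimp.
  exact: (rcM rP Px (rcX n rP Pg)).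
- exists 1%N; split; first by rewrite expgS expg1; gsimp.
  exact: (rcM rP Pg (rcX 1 rP Pg)).
Qed.

Section Jump.
Variables (C D : set G).
Hypotheses (sC : subgroup C) (sD : subgroup D) (DC : D `<=` C)
  (cD : convex P D)
  (jump : forall g, C g -> ~ D g -> C `<=` hull P g).

Definition jump_cone : set G := (P `&` C) `\` D.

Lemma jump_rcone : rcone C D jump_cone.
Proof.
have rPC := rcone_down sC (@subsetT _ C) rP.
apply: (rcone_up sC subgroup1 sD) => //; first exact: sub1_subgroup.
move=> x y [Px Cx] nDx Dy; split; first exact: cD.
by apply: (sgM sC) => //; exact: DC.
Qed.

Lemma jump_arch x y : jump_cone x -> C y -> exists n, jump_cone (y^-1 * x ^+ n).
Proof.
move=> Jx Cy; have [[Px Cx] nDx] := Jx.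
have [n Pn] := hull_bounded Px (jump Cx nDx Cy).
have CX k : C (y^-1 * x ^+ k) by apply: (sgM sC) (sgX k sC Cx); exact: (sgV sC).
have [Dn|nDn] := pselect (D (y^-1 * x ^+ n)); last by exists n.
by exists n.+1; rewrite expgSr mulgA; apply: (rcDM sC sD DC jump_rcone).
Qed.

(** If a conjugate [x] of [h] by [f] leaves [D], its powers are cofinal in [C].
    Let [w := f^-1]; cancelling [f] on the left, the elements [h ^+ n * w] are
    also cofinal.  This is absurd if [w] is negative.  If [w] is positive, some
    power [w ^+ k] preserves the order and exceeds all of [D], whence
    [h ^+ n * w <= h ^+ n * w ^+ k < w ^+ (k + k)]. *)
Lemma jump_normal : normal_in C D.
Proof.
move=> f h Cf Dh; apply: contrapT => nDx.
wlog Px : h Dh nDx / P (f * h * f^-1) => [hw|].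
  have : [set: G] (f * h * f^-1) by [].
  case/(rc3 rP)=> [|/= x1|Px]; first exact: hw.
    by apply: nDx; rewrite x1; exact: sg1.
  apply: (hw h^-1); first exact: (sgV sD).
    by move=> Dx; apply: nDx; have := sgV sD Dx; gsimp.
  by move: Px; gsimp.
set x := f * h * f^-1 in nDx Px.
have nDf : ~ D f.
  by move=> Df; apply: nDx; apply: (sgM sD) (sgV sD Df); exact: (sgM sD).
have Cx : C x by do ?apply: (sgM sC) => //; [exact: DC|exact: (sgV sC)].
have Jx : jump_cone x by [].
have xX n : x ^+ n = f * h ^+ n * f^-1.
  by elim: n => [|n IH]; rewrite ?expg0 ?expgS ?IH /x; gsimp.
have DX n : D (h ^+ n) := sgX n sD Dh.
case: (rc3 jump_rcone Cf) => // [Jf|JF].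
  have [n Jn] := jump_arch Jx Cf.
  apply: (rcVN sD jump_rcone Jn); rewrite xX; gsimp.
  by apply: (rcMD sC sD DC jump_rcone) => //; exact: (sgV sD).
have [m em] := recP f^-1.
set k := m.+1 in em; set w := f^-1 in JF em.
have Cw : C w := rcS jump_rcone JF.
have Pw : P w by case: JF => -[].
have CwX i : C (w ^+ i) := sgX i sC Cw.
have [n Jn] := jump_arch Jx (sgM sC Cf (sgM sC (CwX k) (CwX k))).
have Pn : P (w ^- k * w ^- k * h ^+ n * w ^+ k).
  have P1 : P (w ^- k * w ^- k * h ^+ n * w).
    by case: Jn => -[+ _] _; rewrite xX; gsimp; rewrite -/w.
  move: P1; set A := _ * h ^+ n => P1.
  rewrite /k expgS mulgA; case: (m) => [|i]; first by rewrite expg0 mulg1.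
  exact: (rcM rP P1 (rcX i rP Pw)).
have Pn' : P (w ^- k * h ^+ n).
  by have := cone_conjP em Pn; gsimp.
have := rcX m jump_rcone JF; rewrite -/k => Jk.
have := rcDM sC sD DC jump_rcone Jk (sgV sD (DX n)) => -[[P2 _] _].
by apply: (rcVN subgroup1 rP P2); gsimp.
Qed.

Lemma jump_comm_mod : comm_mod C D.
Proof.
exact: (arch_comm_mod sC sD DC jump_normal jump_rcone jump_arch).
Qed.

End Jump.
End Recurrent.

(** * Abelian quotients with countably many orders have rank one *)

Section Rank.
Context {G : groupType}.
Implicit Types (C D E H K P Q R T U M N : set G) (x y z c d g h f : G) (F : seq G).

(** The rank-one condition on [C / D]: any two nontrivial elements have a common
    nontrivial power. *)
Definition commensurable C D := forall x y, C x -> ~ D x -> C y -> ~ D y ->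
  exists m n, D (x ^+ m.+1 * y ^+ n.+1) \/ D (x ^+ m.+1 * y ^- n.+1).

Record submonoid C D N : Prop := Submonoid {
  smD : D `<=` N;
  smC : N `<=` C;
  smM : forall x y, N x -> N y -> N (x * y) }.

(** For submonoids modulo [D]: no nontrivial units, as for the set of nonnegative
    elements of an order. *)
Definition pointed D N := forall x, N x -> N x^-1 -> D x.

Definition adjoin C N f : set G := [set x | C x /\ exists e, N (x * f ^- e)].

Variables (C D : set G).
Hypotheses (sC : subgroup C) (sD : subgroup D) (DC : D `<=` C) (CD : comm_mod C D).

Lemma comm_mod_normal : normal_in C D.
Proof.
move=> c d Cc Dd; have := sgM sD (CD Cc (DC Dd)) Dd; by gsimp.
Qed.
Let nD := comm_mod_normal.

Definition eqD x y := D (x * y^-1).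

Lemma eqD_sym x y : eqD x y -> eqD y x.
Proof. by move=> /(sgV sD); rewrite /eqD; gsimp. Qed.

Lemma eqD_trans y x z : eqD x y -> eqD y z -> eqD x z.
Proof. by move=> xy /(sgM sD xy); rewrite /eqD; gsimp. Qed.

Lemma eqD_refl x : eqD x x.
Proof. by rewrite /eqD mulgV; exact: sg1. Qed.

Lemma eqDM x x' y y' : C x -> eqD x x' -> eqD y y' -> eqD (x * y) (x' * y').
Proof. by move=> Cx xx' /(nD Cx) /(sgM sD)/(_ xx'); rewrite /eqD; gsimp. Qed.

Lemma eqDC x y : C x -> C y -> eqD (x * y) (y * x).
Proof. by move=> Cx Cy; rewrite /eqD; gsimp; exact: CD. Qed.

Lemma eqDX x y n : C x -> eqD x y -> eqD (x ^+ n) (y ^+ n).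
Proof.
move=> Cx xy; elim: n => [|n IH]; first exact: eqD_refl.
by rewrite !expgS; exact: eqDM.
Qed.

Lemma eqDMX x y n : C x -> C y -> eqD ((x * y) ^+ n) (x ^+ n * y ^+ n).
Proof.
move=> Cx Cy; elim: n => [|n IH]; first by rewrite !expg0 mulg1; exact: eqD_refl.
have Cxy := sgM sC Cx Cy; rewrite !expgS.
apply: eqD_trans (eqDM Cxy (eqD_refl _) IH) _.
rewrite -!mulgA; apply: eqDM (eqD_refl _) _ => //; rewrite !mulgA.
apply: eqDM (eqD_refl _); first exact: (sgM sC Cy (sgX n sC Cx)).
exact: (eqDC Cy (sgX n sC Cx)).
Qed.

Lemma sm_eqD N x y : submonoid C D N -> N x -> eqD y x -> N y.
Proof. by move=> sN Nx /(smD sN) Nyx; have := smM sN Nyx Nx; gsimp. Qed.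

Lemma smX N x n : submonoid C D N -> N x -> N (x ^+ n).
Proof.
move=> sN Nx; elim: n => [|n IH]; first by apply: (smD sN); exact: sg1.
by rewrite expgS; exact: (smM sN).
Qed.

Section Adjoin.
Variables (N : set G) (f : G).
Hypotheses (sN : submonoid C D N) (Cf : C f).
Let CfX n : C (f ^+ n). Proof. exact: sgX. Qed.

Lemma adjoin_mul x y m n : C x -> C y ->
  N (x * f ^- m) -> N (y * f ^- n) -> N (x * y * f ^- (m + n)).
Proof.
move=> Cx Cy Nx Ny; apply: sm_eqD (smM sN Nx Ny) _ => //.
rewrite expgnDr invgM -!mulgA; apply: eqDM (eqD_refl _) _ => //.
rewrite [X in eqD X _]mulgA; apply: eqDC; last exact: (sgV sC (CfX m)).
by apply: (sgM sC) => //; exact: (sgV sC (CfX n)).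
Qed.

Lemma adjoin_pow x m k : C x -> N (x * f ^- m) -> N (x ^+ k * f ^- (m * k)).
Proof.
move=> Cx Nx; elim: k => [|k IH].
  by rewrite muln0 !expg0 invg1 mulg1; apply: (smD sN); exact: sg1.
by rewrite expgS mulnS; apply: adjoin_mul => //; exact: sgX.
Qed.

Lemma sub_adjoin : N `<=` adjoin C N f.
Proof.
by move=> x Nx; split; [exact: (smC sN)|exists 0; rewrite expg0 invg1 mulg1].
Qed.

Lemma adjoin_gen : adjoin C N f f.
Proof. by split=> //; exists 1%N; rewrite expg1 mulgV; apply: (smD sN); exact: sg1. Qed.

Lemma adjoin_submonoid : submonoid C D (adjoin C N f).
Proof.
split; first by move=> x /(smD sN); exact: sub_adjoin.
  by move=> x [].
move=> x y [Cx [m xm]] [Cy [n yn]]; split; first exact: (sgM sC).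
by exists (m + n)%N; exact: adjoin_mul.
Qed.

(** Multiplying [x] and [x^-1] in the enlarged monoid cancels [x] and leaves a
    negative power of [f] in [N]. *)
Lemma adjoin_pointed : pointed D N -> (forall n, ~ N (f^-1 ^+ n.+1)) ->
  pointed D (adjoin C N f).
Proof.
move=> pN nf x [Cx [m xm]] [Cx' [n xn]].
have := adjoin_mul Cx Cx' xm xn; rewrite mulgV mul1g.
case E : (m + n)%N => [|k]; last by rewrite -expVgn => /nf.
move=> _; move/eqP: E; rewrite addn_eq0 => /andP[/eqP m0 /eqP n0].
by move: xm xn; rewrite m0 n0 expg0 invg1 !mulg1; exact: pN.
Qed.

End Adjoin.

Lemma adjoin_swap N f g : submonoid C D N -> C f -> C g ->
  adjoin C (adjoin C N f) g `<=` adjoin C (adjoin C N g) f.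
Proof.
move=> sN Cf Cg x [Cx [n [_ [m Nx]]]]; split=> //; exists m; split.
  by apply: (sgM sC) => //; exact: (sgV sC (sgX m sC Cf)).
exists n; apply: sm_eqD Nx _ => //; rewrite -!mulgA; apply: eqDM (eqD_refl _) _ => //.
apply: eqDC; apply: (sgV sC); exact: sgX.
Qed.

(** A maximal pointed submonoid is total: if neither [x] nor [x^-1] could be
    adjoined, it would contain powers of both, making [x] a torsion element. *)
Lemma pointed_extend N T : rcone C D T -> submonoid C D N -> pointed D N ->
  exists2 U, rcone C D U & forall x, N x -> ~ D x -> U x.
Proof.
move=> rT sN pN.
(* Working with [B `|` N] makes the empty chain harmless. *)
pose ok B := submonoid C D (B `|` N) /\ pointed D (B `|` N).
have [|B [[sM pM] maxB]] := @Zorn_bigcup G ok.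
  move=> F okF totF.
  have dir x y : (\bigcup_(X in F) X `|` N) x -> (\bigcup_(X in F) X `|` N) y ->
      exists M, [/\ submonoid C D M, pointed D M, M x, M y &
        M `<=` \bigcup_(X in F) X `|` N].
    have sub X : F X -> X `|` N `<=` \bigcup_(X in F) X `|` N.
      by move=> FX z [Xz|Nz]; [left; exists X|right].
    move=> [[X FX Xx]|Nx] [[Y FY Yy]|Ny].
    - have [XY|YX] := totF _ _ FX FY.
      + exists (Y `|` N); have [sY pY] := okF _ FY; split=> //; last exact: sub.
          by left; exact: XY.
        by left.
      + exists (X `|` N); have [sX pX] := okF _ FX; split=> //; last exact: sub.
          by left.
        by left; exact: YX.
    - by exists (X `|` N); have [sX pX] := okF _ FX; split=> //; [left|right|exact: sub].
    - by exists (Y `|` N); have [sY pY] := okF _ FY; split=> //; [right|left|exact: sub].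
    - by exists N; split=> // z Nz; right.
  split.
    split=> [x Dx|x Ux|x y Ux Uy].
    - by right; exact: (smD sN).
    - by have [M [sM _ Mx _ _]] := dir x x Ux Ux; exact: (smC sM).
    - by have [M [sM _ Mx My sub]] := dir x y Ux Uy; apply: sub; exact: (smM sM).
  move=> x Ux Ux'; have [M [_ pM Mx Mx' _]] := dir _ _ Ux Ux'; exact: pM.
set M := B `|` N in sM pM.
have NM : N `<=` M by move=> x; right.
have maxM x : C x -> ~ M x -> exists n, M (x^-1 ^+ n.+1).
  move=> Cx nMx; apply: contrapT => nex.
  apply: (maxB (adjoin C M x)).
    split=> [z Bz|sub]; first by apply: (sub_adjoin x sM); left.
    by apply: nMx; left; apply: sub; exact: (adjoin_gen sM).
  rewrite /ok; have -> : adjoin C M x `|` N = adjoin C M x.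
    by apply/seteqP; split=> [z [//|/NM]|z]; [exact: sub_adjoin|left].
  split; first exact: adjoin_submonoid.
  by apply: adjoin_pointed => // n Mn; apply: nex; exists n.
exists (M `\` D); last by move=> x /NM.
split.
- by move=> x [/(smC sM)].
- move=> x y [Mx nDx] [My nDy]; split; first exact: (smM sM).
  move=> Dxy; apply: nDx; apply: pM => //.
  by have := smM sM My (smD sM (sgV sD Dxy)); gsimp.
- move=> x Cx; have [Dx|nDx] := pselect (D x); first exact: Or32.
  have [Mx|nMx] := pselect (M x); first exact: Or31.
  have [Mx'|nMx'] := pselect (M x^-1).
    by apply: Or33; split=> // /(sgVE _ sD).
  have [n Mn] := maxM x Cx nMx; have [m] := maxM _ (sgV sC Cx) nMx'; rewrite invgK => Mm.
  case: nDx; apply: (rc_root sD rT Cx (n := (m.+1 * n.+1).-1)).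
  rewrite prednK ?muln_gt0 //; apply: pM.
    by rewrite expgnA; exact: smX.
  by rewrite mulnC expgnA -!expVgn; exact: smX.
- by move=> x [].
Qed.

Definition generated F : set G := foldr (fun f N => adjoin C N f) D F.

Lemma generated_submonoid F : (forall f, f \in F -> C f) ->
  submonoid C D (generated F).
Proof.
elim: F => [|f F IH] FC /=; first by split=> // x y; exact: (sgM sD).
apply: adjoin_submonoid; last by apply: FC; exact: mem_head.
by apply: IH => g Fg; apply: FC; rewrite inE Fg orbT.
Qed.

Lemma sub_generated F f : (forall f, f \in F -> C f) -> f \in F -> generated F f.
Proof.
elim: F => [|g F IH] FC //=.
have FC' h : h \in F -> C h by move=> Fh; apply: FC; rewrite inE Fh orbT.
have sF := generated_submonoid FC'.
rewrite inE => /predU1P[->|Ff]; first by apply: adjoin_gen => //; apply: FC; exact: mem_head.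
by apply: sub_adjoin => //; exact: IH.
Qed.

Section Isolated.
Variables (T : set G).
Hypothesis rT : rcone C D T.
Let TC x : T x -> C x. Proof. exact: (rcS rT). Qed.

Lemma generated_nonneg F x : (forall f, f \in F -> T f) -> generated F x -> T x \/ D x.
Proof.
elim: F x => [|f F IH] x FT /=; first by right.
move=> [Cx [e /IH]].
have FT' g : g \in F -> T g by move=> Fg; apply: FT; rewrite inE Fg orbT.
case: e => [|e]; first by rewrite expg0 invg1 mulg1; exact.
have Tf : T (f ^+ e.+1) by apply: (rcX _ rT); apply: FT; exact: mem_head.
case=> // h; left; first by have := rcM rT h Tf; gsimp.
by have := rcDM sC sD DC rT Tf h; gsimp.
Qed.

Lemma generated_pointed F : (forall f, f \in F -> T f) -> pointed D (generated F).
Proof.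
move=> FT x /(generated_nonneg FT)[Tx|//] /(generated_nonneg FT)[Tx'|/(sgVE _ sD)//].
by case: (rcVN sD rT Tx Tx').
Qed.

(** If no power of [x] were generated by [F], then [x^-1] could be adjoined and
    an order other than [T] would contain [F]. *)
Lemma isolated_root F : (forall f, f \in F -> T f) ->
  (forall U, rcone C D U -> (forall f, f \in F -> U f) -> U = T) ->
  forall x, T x -> exists n, generated F (x ^+ n.+1).
Proof.
move=> FT isoT x Tx; apply: contrapT => nex.
have FC f : f \in F -> C f by move/FT/TC.
have sF := generated_submonoid FC.
have Cx' := sgV sC (TC Tx).
have [||U rU UP] := @pointed_extend (adjoin C (generated F) x^-1) T rT.
- exact: adjoin_submonoid.
- apply: adjoin_pointed => //; first exact: generated_pointed.
  by move=> n; rewrite invgK => Fn; apply: nex; exists n.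
have UT : U = T.
  apply: isoT => // f Ff; apply: UP; last exact: (rcD rT (FT _ Ff)).
  by apply: sub_adjoin => //; exact: sub_generated.
apply: (rcVN sD rT Tx); rewrite -UT; apply: UP; first exact: adjoin_gen.
by move/(sgVE _ sD); exact: (rcD rT Tx).
Qed.

(** In additive notation, [n.+1 (f - g) = e f + w] with [w] in [N].  If
    [e <= n], then a positive multiple of [f] lies in [N]; otherwise a sum of
    positive elements vanishes. *)
Lemma redundant N f g n e : submonoid C D N -> (forall x, N x -> T x \/ D x) ->
  T f -> T g -> N g -> N ((f * g^-1) ^+ n.+1 * f ^- e) ->
  exists s, N (f ^+ s.+1).
Proof.
move=> sN NT Tf Tg Ng Nz.
have Cg := TC Tg; have Cf := TC Tf; have Cg' := sgV sC Cg.
have CgX k : C (g ^+ k) := sgX k sC Cg.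
have CfX k : C (f ^+ k) := sgX k sC Cf.
have {Nz} N1 : N (f ^+ n.+1 * f ^- e * g ^- n.+1).
  apply: sm_eqD Nz _ => //.
  have ez := eqDMX n.+1 Cf Cg'.
  have C1 : C (f ^+ n.+1 * f ^- e * g ^- n.+1).
    by do 2?[apply: (sgM sC) => //]; exact: (sgV sC).
  apply: (@eqD_trans (f ^+ n.+1 * g^-1 ^+ n.+1 * f ^- e)).
    rewrite -!mulgA expVgn; apply: eqDM (eqD_refl _) _ => //.
    by apply: eqDC; exact: (sgV sC).
  apply: eqDM (eqD_refl _); last exact: eqD_sym.
  by apply: (sgM sC) => //; exact: (sgX n.+1 sC Cg').
have [en|ne] := leqP e n.
  exists (n - e)%N; have := smM sN N1 (smX n.+1 sN Ng); gsimp.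
  by rewrite -expgnFr ?subSn // ltnW.
have T1 : T (g ^+ n.+1 * f ^+ (e - n.+1)).
  case: (e - n.+1)%N => [|k]; first by rewrite mulg1; exact: (rcX n rT Tg).
  exact: (rcM rT (rcX n rT Tg) (rcX k rT Tf)).
have e1 : (g ^+ n.+1 * f ^+ (e - n.+1))^-1 = f ^+ n.+1 * f ^- e * g ^- n.+1.
  by rewrite expgnFr //; gsimp.
move: N1; rewrite -e1 => /NT[|/(sgVE _ sD)/(rcD rT T1)//].
by move/(rcVN sD rT T1).
Qed.

Definition root_generates F := forall x, T x -> exists n, generated F (x ^+ n.+1).

(** The larger [f] of two generators is superfluous. *)
Lemma root_generates_drop f g F : (forall h, h \in [:: f, g & F] -> T h) ->
  T (f * g^-1) \/ D (f * g^-1) ->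
  root_generates [:: f, g & F] -> root_generates (g :: F).
Proof.
move=> FT Tz gen.
have Tf : T f by apply: FT; exact: mem_head.
have Tg : T g by apply: FT; rewrite !inE eqxx orbT.
have FT' h : h \in g :: F -> T h by move=> Fh; apply: FT; rewrite inE Fh orbT.
have FC' h : h \in g :: F -> C h by move/FT'/TC.
have sN := generated_submonoid FC'.
have Ng := sub_generated FC' (mem_head _ _).
have [s Ns] : exists s, generated (g :: F) (f ^+ s.+1).
  case: Tz => [Tz|Dz].
    have [n [_ [e Nz]]] := gen _ Tz.
    exact: (redundant sN (fun x => generated_nonneg FT') Tf Tg Ng Nz).
  by exists 0; rewrite expg1; exact: (sm_eqD sN Ng).
move=> x Tx; have [n [Cx [e Nx]]] := gen _ Tx.
exists (n.+1 * s.+1).-1; rewrite prednK ?muln_gt0 // expgnA.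
have := adjoin_pow sN (TC Tf) s.+1 Cx Nx.
move/(smM sN)/(_ (smX e sN Ns)).
by rewrite -(expgnA f) [(s.+1 * e)%N]mulnC; gsimp.
Qed.

(** Dropping generators one at a time leaves at most one, of which every positive
    element is then a rational multiple. *)
Lemma root_generates_commensurable F : (forall f, f \in F -> T f) ->
  root_generates F -> commensurable C D.
Proof.
have [k] := ubnP (size F); elim: k F => // k IH [|f [|g F]] leF FT gen.
- have nT x : ~ T x by move=> Tx; have [n /(rcD rT (rcX n rT Tx))] := gen x Tx.
  by move=> x y Cx nDx; case: (rc3 rT Cx) => // /nT.
- have Cf : C f by apply: TC; apply: FT; exact: mem_head.
  have pos x : T x -> exists m n, eqD (x ^+ m.+1) (f ^+ n.+1).
    move=> Tx; have [n [_ [[|e] Dx]]] := gen x Tx; last by exists n, e.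
    by case: (rcD rT (rcX n rT Tx)); move: Dx; rewrite /= expg0 invg1 mulg1.
  have pospos x y : T x -> T y -> exists m n, D (x ^+ m.+1 * y ^- n.+1).
    move=> Tx Ty; have [m [n xf]] := pos x Tx; have [m' [n' yf]] := pos y Ty.
    exists (m.+1 * n'.+1).-1, (m'.+1 * n.+1).-1.
    rewrite !prednK ?muln_gt0 // !expgnA.
    apply: (eqD_trans (eqDX n'.+1 (sgX _ sC (TC Tx)) xf)).
    rewrite (expgnAC f); apply: eqD_sym.
    exact: (eqDX n.+1 (sgX m'.+1 sC (TC Ty)) yf).
  have negr x y : T x -> T y^-1 -> exists m n, D (x ^+ m.+1 * y ^+ n.+1).
    by move=> Tx /(pospos _ _ Tx)[m [n]]; rewrite expVgn invgK; exists m, n.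
  move=> x y Cx nDx Cy nDy.
  have inv a b : C a -> C b -> D (a^-1 * b^-1) -> D (a * b).
    move=> Ca Cb /(sgV sD)/(nD Ca); by gsimp.
  case: (rc3 rT Cx) => // Tx; case: (rc3 rT Cy) => // Ty.
  + by have [m [n]] := pospos _ _ Tx Ty; exists m, n; right.
  + by have [m [n]] := negr _ _ Tx Ty; exists m, n; left.
  + have [m [n]] := pospos _ _ Tx Ty; rewrite expVgn => h.
    by exists m, n; left; apply: inv => //; exact: sgX.
  + have [m [n]] := negr _ _ Tx Ty; rewrite !expVgn => h.
    exists m, n; right; apply: inv; rewrite ?invgK //; first exact: sgX.
    by apply: (sgV sC); exact: sgX.
- have FTf h : h \in f :: F -> T h.
    by move=> Fh; apply: FT; move: Fh; rewrite !inE => /orP[->|->]; rewrite ?orbT.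
  have FTg h : h \in g :: F -> T h by move=> Fh; apply: FT; rewrite inE Fh orbT.
  have Tf : T f := FTf _ (mem_head _ _).
  have Tg : T g := FTg _ (mem_head _ _).
  have Cz : C (f * g^-1) by apply: (sgM sC (TC Tf)); exact: (sgV sC (TC Tg)).
  have [Tz|Tz] : (T (f * g^-1) \/ D (f * g^-1)) \/ T (g * f^-1).
    by case: (rc3 rT Cz) => h; [left; left|left; right|right; move: h; gsimp].
  + by apply: (IH (g :: F)) => //; exact: root_generates_drop gen.
  + apply: (IH (f :: F)) => //; apply: (@root_generates_drop g f F).
    * by move=> h; rewrite !inE orbCA => hh; apply: FT; rewrite !inE.
    * by left.
    * move=> x /gen[n gn]; exists n; apply: adjoin_swap gn.
      - by apply: generated_submonoid => h Fh; apply: TC; apply: FT; rewrite !inE Fh !orbT.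
      - exact: TC.
      - exact: TC.
Qed.

End Isolated.

(** A finite set of sign conditions on a cone amounts to the positivity of
    finitely many elements. *)
Lemma positive_test T F : rcone C D T ->
  exists F', (forall f, f \in F' -> T f) /\
    forall U, rcone C D U -> (forall f, f \in F' -> U f) -> agree F T U.
Proof.
move=> rT; elim: F => [|x F [F' [FT FU]]]; first by exists [::]; split.
have cons z : T z -> (forall U, rcone C D U -> U z -> T x = U x) ->
    exists F', (forall f, f \in F' -> T f) /\
    forall U, rcone C D U -> (forall f, f \in F' -> U f) -> agree (x :: F) T U.
  move=> Tz zU; exists (z :: F'); split=> [f|U rU UF].
    by rewrite inE => /predU1P[->|/FT].
  move=> y; rewrite inE => /predU1P[->|]; first by apply: zU => //; apply: UF; exact: mem_head.
  by apply: FU => // f Ff; apply: UF; rewrite inE Ff orbT.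
have nil : (forall U, rcone C D U -> ~ U x) ->
    exists F', (forall f, f \in F' -> T f) /\
    forall U, rcone C D U -> (forall f, f \in F' -> U f) -> agree (x :: F) T U.
  move=> nU; exists F'; split=> // U rU UF y; rewrite inE => /predU1P[->|]; last exact: FU.
  by apply/propext; split=> h; [case: (nU T rT)|case: (nU U rU)].
have [Cx|nCx] := pselect (C x); last by apply: nil => U rU /(rcS rU).
case: (rc3 rT Cx) => [Tx|Dx|Tx].
- by apply: (cons x) => // U rU Ux; apply/propext.
- by apply: nil => U rU /(rcD rU).
- apply: (cons x^-1) => // U rU Ux; apply/propext; split=> h.
    by case: (rcVN sD rT h).
  by case: (rcVN sD rU h).
Qed.

(** Some order is isolated, hence cut out by finitely many positivity conditions;
    their elements generate it up to roots. *)
Lemma countable_commensurable T : rcone C D T ->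
  countable [set U | rcone C D U] -> commensurable C D.
Proof.
move=> rT cRC; have [|| P [F [rP isoP]]] :=
  @countable_rcone_isolated _ C D [set U | rcone C D U] sD cRC => //.
  by exists T.
have [F' [FP FU]] := positive_test F rP.
apply: (root_generates_commensurable rP FP); apply: isolated_root => // U rU UF.
by apply: isoP => //; exact: FU.
Qed.

End Rank.

(** * Two consecutive rank-one quotients *)

Section TwoJumps.
Context {G : groupType}.
Implicit Types (K P Q R U V : set G) (x y z c d g h f p q : G) (F : seq G).

Lemma commensurable_arch D E T x y : subgroup D -> subgroup E -> E `<=` D ->
  comm_mod D E -> commensurable D E -> rcone D E T ->
  T x -> D y -> exists n, T (y^-1 * x ^+ n).
Proof.
move=> sD sE ED DE ccDE rT Tx Dy.
case: (rc3 rT Dy) => [Ty|Ey|Ty]; last 2 first.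
- by exists 1%N; rewrite expg1; apply: (rcDM sD sE ED rT) => //; exact: (sgV sE).
- by exists 1%N; rewrite expg1; exact: (rcM rT).
have [m [n]] := ccDE _ _ (rcS rT Tx) (rcD rT Tx) Dy (rcD rT Ty).
case=> [Exy|Exy]; first by case: (rcD rT (rcM rT (rcX m rT Tx) (rcX n rT Ty))).
have nE := comm_mod_normal sE ED DE.
have := nE _ _ (sgV sD (sgX n.+1 sD Dy)) Exy; gsimp => Eyx.
exists m.+2; have := rcDM sD sE ED rT Tx Eyx; rewrite [x ^+ m.+2]expgSr.
case: n {Exy Eyx} => [|n]; first by rewrite expg1; gsimp.
move/(rcM rT (rcX n rT Ty)); by congr (T _); gsimp.
Qed.

Variables (C D E : set G).
Hypotheses (sC : subgroup C) (sD : subgroup D) (sE : subgroup E)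
  (DC : D `<=` C) (ED : E `<=` D)
  (CD : comm_mod C D) (ccCD : commensurable C D)
  (DE : comm_mod D E) (ccDE : commensurable D E).
Let nD : normal_in C D. Proof. exact: comm_mod_normal. Qed.
Let EC : E `<=` C. Proof. exact: subset_trans DC. Qed.

Section Reversed.
Variable Q : set G.
Hypotheses (rQ : rcone C [set 1] Q) (cE : convex (Q `&` D) E).
Let T := (Q `&` D) `\` E.

Let rT : rcone D E T.
Proof.
have rQD := rcone_down sD DC rQ.
exact: (rcone_up sD subgroup1 sE (sub1_subgroup sE) ED rQD cE).
Qed.

Let TQ x : T x -> Q x. Proof. by case=> -[]. Qed.

(** As [g] conjugates [x ^+ n] to the inverse of a large element [z ^+ n],
    the equation [z ^+ n * (g * x ^+ n) = g] shows that [g] exceeds all of [D]. *)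
Let reversed_above g x : Q g -> T x -> T (g * x^-1 * g^-1) ->
  forall d, D d -> Q (d * g).
Proof.
move=> Qg Tx Tz d Dd.
have [n] := commensurable_arch sD sE ED DE ccDE rT Tz (sgV sD Dd).
have zX k : (g * x^-1 * g^-1) ^+ k = g * x ^- k * g^-1.
  by rewrite -expVgn; elim: k => [|k IH]; rewrite ?expg0 ?expgS ?IH; gsimp.
rewrite zX invgK => /TQ Qd.
have Qgx : Q (g * x ^+ n).
  case: n {Qd} => [|n]; first by rewrite expg0 mulg1.
  by apply: (rcM rQ) => //; apply: (rcX _ rQ); exact: TQ.
by have := rcM rQ Qd Qgx; gsimp.
Qed.

(** A positive [h] bounded by an element of [D] has all its powers bounded by
    elements of [D], but one of them is a power of [g] or of [g^-1] modulo [D]. *)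
Let above_convex g : C g -> ~ D g -> (forall d, D d -> Q (d * g)) -> convex Q D.
Proof.
move=> Cg nDg Qdg h d Qh nDh Dd.
have Ch := rcS rQ Qh.
have QdgX k d' : D d' -> Q (d' * g ^+ k.+1).
  elim: k d' => [|k IH] d' Dd'; first by rewrite expg1; exact: Qdg.
  rewrite expgS mulgA; apply: (rcM rQ (Qdg _ Dd')).
  by have := IH 1 (sg1 sD); rewrite mul1g.
have : C (d * h) by apply: (sgM sC) => //; exact: DC.
case/(rc3 rQ)=> // [/= dh1|Qdh]; exfalso.
  by apply: nDh; rewrite -(mulKg d h) dh1 mulg1; exact: (sgV sD).
have below l : exists2 d', D d' & Q (h ^- l.+1 * d').
  elim: l => [|l [d' Dd' Qd']].
    by exists d^-1; [exact: (sgV sD)|rewrite expg1; move: Qdh; gsimp].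
  exists (h * d' * h^-1 * d^-1); first by apply: (sgM sD); [exact: nD|exact: (sgV sD)].
  by have := rcM rQ Qd' Qdh; rewrite [h ^+ l.+2]expgS; gsimp.
have [a [b [Dhg|Dhg]]] := ccCD Ch nDh Cg nDg.
- have := nD (sgX b.+1 sC Cg) (sgV sD Dhg); gsimp => Dg.
  have := QdgX b _ Dg; gsimp => Q1.
  by apply: (rcVN subgroup1 rQ (rcX a rQ Qh)); move: Q1; gsimp.
- have [d' Dd' Qd'] := below a.
  have := QdgX b _ (sgM sD (sgV sD Dd') Dhg); gsimp => Q1.
  by apply: (rcVN subgroup1 rQ Qd'); gsimp.
Qed.

(** Replacing [g] by its inverse exchanges [x] with the inverse of its conjugate,
    so [g] may be taken positive; it then exceeds [D]. *)
Lemma reversed_convex g x : C g -> T x -> T (g * x^-1 * g^-1) -> convex Q D.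
Proof.
move=> Cg Tx Tz.
have nDg : ~ D g.
  move=> Dg; apply: (rcD rT (rcM rT Tz Tx)).
  by have := DE Dg (sgV sD (rcS rT Tx)); gsimp.
case: (rc3 rQ Cg) => [Qg|/= g1|Qg].
- exact: (above_convex Cg nDg (reversed_above Qg Tx Tz)).
- by case: nDg; rewrite g1; exact: sg1.
- apply: (@above_convex g^-1); [exact: (sgV sC)|by move/(sgVE _ sD)|].
  by apply: (reversed_above Qg Tz); gsimp.
Qed.

End Reversed.

(** * Two quotients on which the action preserves the order *)

Section Positive.
Variables (T V : set G) (x0 t0 : G).
Hypotheses (rT : rcone D E T) (rV : rcone C D V) (nE : normal_in C E)
  (T_conj : forall c x, C c -> T x -> T (c * x * c^-1))
  (Tx0 : T x0) (Ct0 : C t0) (nDt0 : ~ D t0)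
  (cRC : countable [set U | rcone C E U]).

Let TC x : T x -> C x. Proof. by move/(rcS rT)/DC. Qed.
Let TE x d : T x -> E d -> T (x * d). Proof. exact: (rcMD sD sE ED rT). Qed.
Let ET x d : T x -> E d -> T (d * x). Proof. exact: (rcDM sD sE ED rT). Qed.

(** The commutator pairing of [C / D] with values in the central [D / E] is
    multiplicative, so it vanishes: some power of [f] is a power of [g] times
    an element of [D]. *)
Lemma comm_mod_of_central : (forall c d, C c -> D d -> E (c * d * c^-1 * d^-1)) ->
  comm_mod C E.
Proof.
move=> cen f g Cf Cg.
have [Df|nDf] := pselect (D f).
  by have := sgV sE (cen _ _ Cg Df); gsimp.
have [Dg|nDg] := pselect (D g); first exact: cen.
set k := f * g * f^-1 * g^-1; have Dk : D k by exact: CD.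
pose ck n := f ^+ n * g * f ^- n * g^-1.
have Dck n : D (ck n) by apply: CD => //; exact: sgX.
have ckX n : eqD E (ck n) (k ^+ n).
  elim: n => [|n IH].
    by rewrite /ck !expg0; gsimp; rewrite /eqD mulgV; exact: sg1.
  have -> : ck n.+1 = (f * ck n * f^-1) * k by rewrite /ck /k expgS; gsimp.
  rewrite expgSr; apply: (eqDM sE ED DE _ _ (eqD_refl sE _)); first exact: nD.
  apply: (eqD_trans sE _ IH); exact: cen.
have [a [b Dfg]] := ccCD Cf nDf Cg nDg.
have [d Dd [e [fa comm_e]]] : exists2 d, D d & exists e, f ^+ a.+1 = d * e /\ commute e g.
  case: Dfg => Dfg.
  - exists (f ^+ a.+1 * g ^+ b.+1) => //; exists (g ^- b.+1); split; first by gsimp.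
    by apply: commute_sym; apply: commuteV; apply: commuteX.
  - exists (f ^+ a.+1 * g ^- b.+1) => //; exists (g ^+ b.+1); split; first by gsimp.
    by apply: commute_sym; apply: commuteX.
have Eck : E (ck a.+1).
  have := sgV sE (cen _ _ Cg Dd); congr (E _); rewrite /ck fa; gsimp.
  by rewrite -(mulgA d e g) comm_e; gsimp.
apply: (rc_root sE rT Dk (n := a)).
by have := sgM sE (eqD_sym sE (ckX a.+1)) Eck; gsimp.
Qed.

Let phi g x := g * x * g^-1 * x^-1.
Let phiD g x : C g -> D x -> D (phi g x).
Proof. by move=> Cg Dx; apply: (sgM sD) (sgV sD Dx); exact: nD. Qed.

Let phiM g x y : C g -> D x -> D y -> eqD E (phi g (x * y)) (phi g x * phi g y).
Proof.
move=> Cg Dx Dy.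
have -> : phi g (x * y) = (g * x * g^-1) * (phi g y * x^-1) by rewrite /phi; gsimp.
have -> : phi g x * phi g y = (g * x * g^-1) * (x^-1 * phi g y) by rewrite /phi; gsimp.
apply: (eqDM sE ED DE _ (eqD_refl sE _) _); first exact: nD.
by apply: (eqDC DE); [exact: phiD|exact: (sgV sD)].
Qed.

Let phiX g x n : C g -> D x -> eqD E (phi g (x ^+ n)) (phi g x ^+ n).
Proof.
move=> Cg Dx; elim: n => [|n IH].
  by rewrite /phi !expg0; gsimp; rewrite /eqD mulgV; exact: sg1.
rewrite !expgS; apply: (eqD_trans sE (phiM Cg Dx (sgX n sD Dx))).
by apply: (eqDM sE ED DE _ (eqD_refl sE _) IH); exact: phiD.
Qed.

Let phi_eqD g x y : C g -> D x -> D y -> eqD E x y -> eqD E (phi g x) (phi g y).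
Proof.
move=> Cg Dx Dy Exy.
have -> : x = x * y^-1 * y by gsimp.
have Dxy : D (x * y^-1) by exact: ED.
apply: (eqD_trans sE (phiM Cg Dxy Dy)).
rewrite /eqD mulgK; apply: (sgM sE) (sgV sE Exy); exact: nE.
Qed.

(** Modulo [E], the map [phi g] is an endomorphism of the rank-one group [D / E],
    so its sign is the same on all positive elements. *)
Lemma expand_all g x y : C g -> T x -> T (phi g x) -> T y -> T (phi g y).
Proof.
move=> Cg Tx Tgx Ty; have Dx := rcS rT Tx; have Dy := rcS rT Ty.
have [m [n]] := ccDE Dx (rcD rT Tx) Dy (rcD rT Ty).
case=> Exy; first by case: (rcD rT (rcM rT (rcX m rT Tx) (rcX n rT Ty))).
have e1 := phi_eqD Cg (sgX m.+1 sD Dx) (sgX n.+1 sD Dy) Exy.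
have e2 := eqD_trans sE (eqD_sym sE (phiX m.+1 Cg Dx)) (eqD_trans sE e1 (phiX n.+1 Cg Dy)).
have Tm := rcX m rT Tgx.
have Tn : T (phi g y ^+ n.+1).
  by have := ET Tm (eqD_sym sE e2); rewrite mulgVK.
case: (rc3 rT (phiD Cg Dy)) => // [/(sgX n.+1 sE)/(rcD rT Tn)//|/(rcX n rT)].
by rewrite expVgn => /(rcVN sE rT Tn).
Qed.

Definition expanding p := C p /\ forall y, T y -> T (phi p y).

Lemma expanding_exists c d : C c -> D d -> ~ E (c * d * c^-1 * d^-1) ->
  exists p, expanding p.
Proof.
move=> Cc Dd nE1.
wlog Td : d Dd nE1 / T d => [hw|].
  case: (rc3 rT Dd) => [|Ed|Td]; first exact: hw.
    by case: nE1; apply: (sgM sE) (sgV sE Ed); exact: nE.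
  apply: (hw d^-1) => //; first exact: (sgV sD).
  move=> E1; apply: nE1.
  by have := nE (DC Dd) (sgV sE E1); gsimp.
case: (rc3 rT (phiD Cc Dd)) => // Tp.
  by exists c; split=> // y; exact: expand_all Tp.
exists c^-1; split=> [|y]; first exact: (sgV sC).
apply: (expand_all (sgV sC Cc) Td).
by have := T_conj (sgV sC Cc) Tp; rewrite /phi; gsimp.
Qed.

(** [C] acts by conjugation on the coset [D * p], where [u] counts as less than
    [v] when [T (v * u^-1)]; this action preserves the order.  [p < q] are two
    points of the coset, and [p] pushes the other points away from [p]. *)
Definition based p q := expanding p /\ C q /\ T (q * p^-1).

(** In terms of this action: the order recording the motion of [p] and, where [p]
    is fixed, that of [q]. *)
Definition base_cone p q : set G :=
  [set g | C g /\ (T (phi g p) \/ E (phi g p) /\ T (phi g q))].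

Let phi_mul g h p : phi (g * h) p = (g * phi h p * g^-1) * phi g p.
Proof. by rewrite /phi; gsimp. Qed.

Let phi_inv g p : phi g^-1 p = g^-1 * (phi g p)^-1 * g^-1^-1.
Proof. by rewrite /phi; gsimp. Qed.

Let phi_base g p q : phi g (q * p^-1) = phi g q * ((q * p^-1) * (phi g p)^-1 * (q * p^-1)^-1).
Proof. by rewrite /phi; gsimp. Qed.

(** Fixing two points makes [g] act trivially on [D / E].  Outside [D] a power of
    [g] would agree modulo [D] with a power of [p], which acts by expansion.
    Inside [D], fixing [p] means commuting with an expanding element. *)
Lemma based_faithful p q g : based p q -> C g ->
  E (phi g p) -> E (phi g q) -> E g.
Proof.
move=> [[Cp Tp] [Cq Tqp]] Cg Ep Eq.
have fix_mul x k l : C k -> E (phi k x) -> E (phi l x) -> E (phi (k * l) x).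
  by move=> Ck Ek El; rewrite phi_mul; apply: (sgM sE) => //; exact: nE.
have fix_inv x k : C k -> E (phi k x) -> E (phi k^-1 x).
  by move=> Ck Ek; rewrite phi_inv; apply: nE; [exact: (sgV sC)|exact: (sgV sE)].
have fixX x k n : C k -> E (phi k x) -> E (phi (k ^+ n) x).
  move=> Ck Ek; elim: n => [|n IH]; first by rewrite expg0 /phi; gsimp; exact: sg1.
  by rewrite expgS; exact: fix_mul.
set x := q * p^-1 in Tqp *.
have Egx : E (phi g x).
  rewrite phi_base; apply: (sgM sE) => //; apply: nE; last exact: (sgV sE).
  exact: TC.
have fixD d : D d -> E (phi d x) by move=> Dd; apply: DE => //; exact: (rcS rT).
have nDp : ~ D p by move=> /fixD /(rcD rT (Tp _ Tqp)).
have expand n : ~ E (phi (p ^+ n.+1) x).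
  apply: (rcD rT); elim: n => [|n IH]; first by rewrite expg1; exact: Tp.
  by rewrite expgS phi_mul; apply: (rcM rT); [exact: T_conj|exact: Tp].
have Dg : D g.
  apply: contrapT => nDg; have [a [b Dgp]] := ccCD Cg nDg Cp nDp.
  have Cga := sgX a.+1 sC Cg; have Ega := fixX x g a.+1 Cg Egx.
  have Cga' := sgV sC Cga.
  case: Dgp => /fixD Efix; apply: (expand b).
    by have := fix_mul _ _ _ Cga' (fix_inv _ _ Cga Ega) Efix; rewrite mulKg.
  have := fix_mul _ _ _ Cga' (fix_inv _ _ Cga Ega) Efix; rewrite mulKg.
  by move/(fix_inv _ _ (sgV sC (sgX b.+1 sC Cp))); rewrite invgK.
case: (rc3 rT Dg) => // Tg; exfalso.
  by apply: (rcD rT (Tp _ Tg)); move: (sgV sE Ep); rewrite /phi; gsimp.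
by apply: (rcD rT (T_conj Cg (Tp _ Tg))); move: Ep; rewrite /phi; gsimp.
Qed.

Lemma base_cone_rcone p q : based p q -> rcone C E (base_cone p q).
Proof.
move=> bpq; have [[Cp Tp] [Cq Tqp]] := bpq.
split.
- by move=> g [].
- move=> g h [Cg pg] [Ch ph]; split; first exact: (sgM sC).
  rewrite !phi_mul; case: pg => [Tg|[Eg Tg]]; case: ph => [Th|[Eh Th]].
  + by left; apply: (rcM rT) => //; exact: T_conj.
  + by left; apply: ET => //; exact: nE.
  + by left; apply: TE => //; exact: T_conj.
  + right; split; first by apply: (sgM sE) => //; exact: nE.
    by apply: (rcM rT) => //; exact: T_conj.
- move=> g Cg; have Cg' := sgV sC Cg.
  have [Tg|Eg|Tg] := rc3 rT (CD Cg Cp : D (phi g p)).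
  + by apply: Or31; split=> //; left.
  + have [Th|Eh|Th] := rc3 rT (CD Cg Cq : D (phi g q)).
    * by apply: Or31; split=> //; right.
    * by apply: Or32; exact: (based_faithful bpq).
    * apply: Or33; split=> //; right; rewrite !phi_inv; split; last exact: T_conj.
      by apply: nE => //; exact: (sgV sE).
  + by apply: Or33; split=> //; left; rewrite phi_inv; exact: T_conj.
- move=> g [Cg pg] Eg.
  have Ephi r : C r -> E (phi g r).
    move=> Cr; have := sgM sE Eg (nE Cr (sgV sE Eg)).
    by rewrite /phi; gsimp.
  by case: pg => [/(rcD rT)|[_ /(rcD rT)]]; apply; exact: Ephi.
Qed.

Let lower_bound (L : seq G) : exists2 y, T y &
  forall c, c \in L -> T c -> T (c * y^-1) \/ E (c * y^-1).
Proof.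
elim: L => [|c L [y Ty yL]]; first by exists x0.
have [Tc|nTc] := pselect (T c); last first.
  by exists y => // d; rewrite inE => /predU1P[->//|]; exact: yL.
have Dcy : D (c * y^-1).
  by apply: (sgM sD); [exact: (rcS rT)|exact: (sgV sD (rcS rT Ty))].
have [le|Tyc] : (T (c * y^-1) \/ E (c * y^-1)) \/ T (y * c^-1).
- by case: (rc3 rT Dcy) => h; [left; left|left; right|right; move: h; gsimp].
- by exists y => // d; rewrite inE => /predU1P[->//|]; exact: yL.
exists c => // d; rewrite inE => /predU1P[->_|Ld Td].
  by right; rewrite mulgV; exact: sg1.
left; have -> : d * c^-1 = d * y^-1 * (y * c^-1) by gsimp.
by case: (yL d Ld Td) => h; [exact: (rcM rT)|exact: ET].
Qed.

(** Move the base point [p] up to [y * p], not above any of the points to which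
    the finitely many elements at hand move [p] up.  An element with [g p > p]
    then satisfies [g (y p) > g p >= y p]; one fixing [p] and moving [q] up
    expands the coset from [p], so it also moves [y p] up.  The cones differ at
    [y * p], which fixes the new base point and moves the old one down. *)
Lemma base_cone_not_isolated p q F : based p q -> exists p' q',
  [/\ based p' q', agree F (base_cone p q) (base_cone p' q') &
      base_cone p' q' <> base_cone p q].
Proof.
move=> bpq; have [[Cp Tp] [Cq Tqp]] := bpq.
(* Inverses are included since both cones are total: preserving positivity
   of [g] and of [g^-1] preserves the sign. *)
have [y Ty yF] := lower_bound [seq phi g p | g <- F ++ [seq g^-1 | g <- F]].
have Cy := TC Ty.
have bpq' : based (y * p) (y * (y * p)).
  split; last by split; [do ?[apply: (sgM sC) => //]|move: Ty; gsimp].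
  split=> [|w Tw]; first exact: (sgM sC).
  have Dv : D (p * w * p^-1) by apply: nD => //; exact: (rcS rT).
  have := ET (Tp _ Tw) (DE (rcS rT Ty) Dv); rewrite /phi; by gsimp.
exists (y * p), (y * (y * p)); split=> //; last first.
  move=> e.
  have : base_cone (y * p) (y * (y * p)) (y * p).
    split; first exact: (sgM sC).
    right; split; first by rewrite /phi; gsimp; exact: sg1.
    by have := bpq'.1.2 _ Ty; rewrite /phi; gsimp.
  rewrite e => -[_].
  have -> : phi (y * p) p = (phi p y)^-1 by rewrite /phi; gsimp.
  have Tpy := Tp _ Ty.
  case=> [/(rcVN sE rT Tpy)//|[/(sgVE _ sE)/(rcD rT Tpy)[]]].
have sub g : g \in F ++ [seq g^-1 | g <- F] ->
    base_cone p q g -> base_cone (y * p) (y * (y * p)) g.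
  move=> Fg [Cg pg]; split=> //; left.
  have -> : phi g (y * p) = (g * y * g^-1) * (phi g p * y^-1) by rewrite /phi; gsimp.
  case: pg => [Tg|[Eg Tg]].
    have [h|h] := yF _ (map_f _ Fg) Tg; first by apply: (rcM rT) => //; exact: T_conj.
    by apply: TE => //; exact: T_conj.
  have Tx : T (phi g (q * p^-1)).
    by rewrite phi_base; apply: TE => //; apply: nE; [exact: TC|exact: (sgV sE)].
  have := TE (expand_all Cg Tqp Tx Ty) (nE Cy Eg).
  by rewrite /phi; gsimp.
have r1 := base_cone_rcone bpq; have r2 := base_cone_rcone bpq'.
move=> g Fg; apply/propext; split.
  by apply: sub; rewrite mem_cat Fg.
move=> bg; case: (rc3 r1 (rcS r2 bg)) => // [/(rcD r2 bg)//|].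
move/sub => h; case: (rcVN sE r2 bg); apply: h.
by rewrite mem_cat map_f ?orbT.
Qed.

(** If [C / E] is abelian, it has rank two, which countability excludes.
    Otherwise some element expands [D / E], and the base cones form a family
    without isolated points. *)
Lemma positive_uncountable : False.
Proof.
have [cen|/existsNP[c /existsNP[d]]] :=
    pselect (forall c d, C c -> D d -> E (c * d * c^-1 * d^-1)).
  have rU := rcone_glue sC sD DC ED rV rT.
  have := countable_commensurable sC sE EC (comm_mod_of_central cen) rU cRC.
  have nEt0 : ~ E t0 by move/ED.
  move/(_ _ _ (TC Tx0) (rcD rT Tx0) Ct0 nEt0) => [m [n Ext]].
  have Dx0 := sgX m.+1 sD (rcS rT Tx0).
  apply: nDt0; apply: (rc_root sD rV Ct0 (n := n)).
  case: Ext => /ED; first by move/(sgMl _ sD Dx0).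
  by move/(sgMl _ sD Dx0)/(sgVE _ sD).
move=> /not_implyP[Cc /not_implyP[Dd nEcd]].
have [p ep] := expanding_exists Cc Dd nEcd.
pose X := [set U | exists p q, based p q /\ U = base_cone p q].
have [||_ [F [[p1 [q1 [b1 ->]]] iso]]] := @countable_rcone_isolated _ C E X sE cRC.
- by move=> U [p1 [q1 [b1 ->]]]; exact: base_cone_rcone.
- exists (base_cone p (x0 * p)), p, (x0 * p); split=> //; split=> //.
  by split; [apply: (sgM sC (TC Tx0)); exact: ep.1|rewrite mulgK].
have [p' [q' [b' ag neq]]] := base_cone_not_isolated F b1.
by apply: neq; apply: iso => //; exists p', q'.
Qed.

End Positive.
End TwoJumps.

(** * Finiteness *)

Section Main.
Context {G : groupType}.
Implicit Types (C D E H K P Q R T U V : set G) (x y z c d g h : G) (F : seq G).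

(** A rank-one quotient has at most two orders, one for each sign of [g]. *)
Lemma commensurable_rcone_unique C D T U g : subgroup C -> subgroup D -> D `<=` C ->
  commensurable C D -> rcone C D T -> rcone C D U -> T g -> U g -> T = U.
Proof.
move=> sC sD DC ccCD rT rU Tg Ug; apply: (rcone_eq sD rT rU) => x Tx.
have Cx := rcS rT Tx.
have [m [n]] := ccCD _ _ Cx (rcD rT Tx) (rcS rT Tg) (rcD rT Tg).
case=> Dxg; first by case: (rcD rT (rcM rT (rcX m rT Tx) (rcX n rT Tg))).
have Ux : U (x ^+ m.+1).
  by have := rcDM sC sD DC rU (rcX n rU Ug) Dxg; rewrite mulgVK.
case: (rc3 rU Cx) => // [/(rcD rT Tx)//|/(rcX m rU)].
by rewrite expVgn => /(rcVN sD rU Ux).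
Qed.

Lemma commensurable_finite C D g : subgroup C -> subgroup D -> D `<=` C ->
  commensurable C D -> C g -> ~ D g -> finite_set [set T | rcone C D T].
Proof.
move=> sC sD DC ccCD Cg nDg.
pose pick h := xget set0 [set T | rcone C D T /\ T h].
apply: (@sub_finite_set _ _ [set pick g; pick g^-1]); last exact: finite_set2.
have pickE T h : rcone C D T -> T h -> T = pick h.
  move=> rT Th; rewrite /pick; case: xgetP => [U _ [rU Uh]|/(_ T)[]//].
  exact: (commensurable_rcone_unique sC sD DC ccCD rT rU Th Uh).
by move=> T rT; case: (rc3 rT Cg) => // h; [left|right]; exact: pickE.
Qed.

Lemma finite_rcone_ext C D E : subgroup C -> subgroup D -> subgroup E ->
  D `<=` C -> E `<=` D ->
  (forall Q, rcone C E Q -> convex Q D) ->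
  finite_set [set T | rcone C D T] -> finite_set [set U | rcone D E U] ->
  finite_set [set Q | rcone C E Q].
Proof.
move=> sC sD sE DC ED cvx fT fU.
apply: (sub_finite_set _ (finite_image2 (fun T U => T `|` U) fT fU)) => Q rQ.
exists (Q `\` D); first exact: (rcone_up sC sE sD ED DC rQ (cvx _ rQ)).
exists (Q `&` D); first exact: (rcone_down sD DC rQ).
by rewrite setUC setUIDK.
Qed.

(** A conjugate of [E] is again convex for [P], hence comparable with [E], and
    rank one leaves no room for a convex subgroup strictly between [E] and
    [D]. *)
Lemma convex_normal C D E P : subgroup C -> subgroup D -> subgroup E ->
  D `<=` C -> E `<=` D -> normal_in C D -> commensurable D E -> ~ (D `<=` E) ->
  rcone D [set 1] P -> (forall U, rcone D [set 1] U -> convex U E) ->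
  normal_in C E.
Proof.
move=> sC sD sE DC ED nD ccDE nDE rP cvx c e Cc Ee.
have rP' : rcone D [set 1] (cone_conj c^-1 P).
  apply: rcone_conj rP => x; rewrite invgK.
    split=> [Dx|]; last exact: nD.
    by have := nD _ _ (sgV sC Cc) Dx; gsimp.
  split=> /= [|->]; last by gsimp.
  by move/(congr1 (fun y => c^-1 * y * c)); gsimp.
pose E1 := [set x | E (c^-1 * x * c)].
have sE1 : subgroup E1 := subgroup_conj c sE.
have E1D : E1 `<=` D.
  by move=> x /ED /(nD _ _ Cc); gsimp.
have cE1 : convex P E1.
  move=> x y Px nx E1y.
  have := cvx _ rP' (c^-1 * x * c) (c^-1 * y * c).
  by rewrite /cone_conj /=; gsimp; apply.
have E1e : E1 (c * e * c^-1) by rewrite /E1 /=; gsimp.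
have [EE1|] := convex_total subgroup1 rP sE sE1 (sub1_subgroup sE)
  (sub1_subgroup sE1) ED E1D (cvx _ rP) cE1;
  last exact.
apply: contrapT => nEe; apply: nDE => t Dt.
have rE1 := rcone_up sD subgroup1 sE1 (sub1_subgroup sE1) E1D rP cE1.
suff : E1 (c * t * c^-1) by rewrite /E1 /=; gsimp.
move: (nD _ _ Cc Dt); move: (c * t * c^-1) => d Dd.
have [/EE1//|nEd] := pselect (E d).
have [m [n Ede]] := ccDE _ _ Dd nEd (E1D _ E1e) nEe.
apply: (rc_root sE1 rE1 Dd (n := m)).
have E1X := sgX n.+1 sE1 E1e.
case: Ede => /EE1; first by move/(sgMr _ sE1 E1X).
by move/(sgMr _ sE1 (sgV sE1 E1X)).
Qed.

Section Induction.
Variable P : set G.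
Hypotheses (cLO : countable (LO G)) (LP : LO G P) (recP : recurrent P).
Let rP : rcone [set: G] [set 1] P. Proof. exact/LO_rcone. Qed.

Definition rational_jump C D :=
  [/\ subgroup D, D `<=` C, ~ (C `<=` D), comm_mod C D & commensurable C D].

Lemma hull1 x : hull P 1 x -> x = 1.
Proof.
by move/(_ [set 1] subgroup1); apply=> // y z Py _ ->; rewrite mul1g.
Qed.

Lemma hull_max C (s : seq (set G)) g : C g -> g <> 1 ->
  (forall h, C h -> h <> 1 -> hull P h \in s) ->
  exists m, [/\ C m, m <> 1 & forall h, C h -> hull P h `<=` hull P m].
Proof.
move=> Cg ng1 Cs.
have [m [Cm nm1 max]] : exists m, [/\ C m, m <> 1 &
    forall h, C h -> hull P h \in s -> hull P h `<=` hull P m].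
  elim: s {Cs} => [|K s [m [Cm nm1 max]]]; first by exists g.
  have [[k [Ck ek nle]]|nk] := pselect (exists k, [/\ C k, hull P k = K &
      ~ (hull P k `<=` hull P m)]); last first.
    exists m; split=> // h Ch; rewrite inE => /predU1P[eh|]; last exact: max.
    by apply: contrapT => nle; apply: nk; exists h.
  have mk : hull P m `<=` hull P k.
    by case: (hull_total LP k m) => h; [exact: hull_sub|case: nle; exact: hull_sub].
  exists k; split=> //.
    move=> k1; apply: nle; rewrite k1 => x /hull1->; exact: (sg1 (hull_subgroup P m)).
  move=> h Ch; rewrite inE => /predU1P[->|hs]; first by rewrite ek.
  exact: subset_trans (max h Ch hs) mk.
exists m; split=> // h Ch.
have [->|nh1] := pselect (h = 1); last by apply: max => //; exact: Cs.
by move=> x /hull1->; exact: (sg1 (hull_subgroup P m)).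
Qed.

(** Take [m] in [C] with the largest hull, and for [D] the elements of [C] whose
    hull omits [m].  The list [s] of hulls is the measure for the induction
    below. *)
Lemma top_jump C (s : seq (set G)) : subgroup C -> convex P C -> ~ (C `<=` [set 1]) ->
  (forall h, C h -> h <> 1 -> hull P h \in s) ->
  exists D (s' : seq (set G)), [/\ rational_jump C D, convex P D, (size s' < size s)%N &
    forall h, D h -> h <> 1 -> hull P h \in s'].
Proof.
move=> sC cC nC1 Cs.
have [g Cg ng1] : exists2 g, C g & g <> 1.
  by apply: contrapT => ng; apply: nC1 => x Cx; apply: contrapT => nx; apply: ng; exists x.
have [m [Cm nm1 max]] := hull_max Cg ng1 Cs.
pose D := [set h | C h /\ ~ hull P h m].
have DC : D `<=` C by move=> x [].
have nDm : ~ D m by move=> [_]; apply; exact: hull_id.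
have sD : subgroup D.
  split.
  - by split; [exact: sg1|move/hull1].
  - move=> x y [Cx nx] [Cy ny]; split; first exact: (sgM sC).
    case: (hull_total LP x y) => h xym.
      exact: nx (hull_sub (sgM (hull_subgroup P x) (hull_id P x) h) xym).
    exact: ny (hull_sub (sgM (hull_subgroup P y) h (hull_id P y)) xym).
  - by move=> x [Cx nx]; split; [exact: (sgV sC)|rewrite hullV].
have cD : convex P D.
  move=> x y Px nDx [Cy ny]; have [Cx|nCx] := pselect (C x); last exact: cC.
  apply: (@hull_convex _ P y) => // hx.
  apply: ny; apply: (hull_sub hx); apply: contrapT => nh; exact: nDx.
have jump h : C h -> ~ D h -> C `<=` hull P h.
  move=> Ch nDh k Ck; have hm : hull P h m by apply: contrapT => nh; apply: nDh.
  exact (hull_sub hm (max k Ck k (hull_id P k))).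
have CD := jump_comm_mod LP recP sC sD DC cD jump.
have ccCD : commensurable C D.
  apply: (countable_commensurable sC sD DC CD (jump_rcone LP sC sD DC cD)).
  exact: (countable_rcone cLO LP).
exists D, [seq K <- s | K != hull P m]; split=> //.
- by split=> // /(_ m Cm).
- rewrite size_filter -(count_predC (pred1 (hull P m)) s) -addn1 addnC leq_add2r.
  by rewrite -has_count has_pred1 Cs.
- move=> h [Ch nh] nh1; rewrite mem_filter Cs // andbT; apply/eqP => e.
  by apply: nh; rewrite e; exact: hull_id.
Qed.

(** The convexity of [D] in all orders of [C] is what makes the induction work:
    an order of [C] is then given by orders of [C / D] and [D].  It holds
    because otherwise no element of [C] reverses [D / E], for the next subgroup
    [E], and uncountably many orders appear. *)
Lemma convex_finite (s : seq (set G)) C : subgroup C -> convex P C ->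
  (forall h, C h -> h <> 1 -> hull P h \in s) ->
  finite_set [set Q | rcone C [set 1] Q] /\
  (C `<=` [set 1] \/ exists2 D, rational_jump C D &
     forall Q, rcone C [set 1] Q -> convex Q D).
Proof.
have [k] := ubnP (size s); elim: k s C => // k IH s C szs sC cC Cs.
have [C1|nC1] := pselect (C `<=` [set 1]).
  split; last by left.
  apply: (@sub_finite_set _ _ [set set0]); last exact: finite_set1.
  move=> Q rQ; apply/seteqP; split=> // x Qx.
  by case: (rcD rQ Qx); apply: C1; exact: (rcS rQ Qx).
have [D [s' [[sD DC nCD CD ccCD] cD szs' Ds']]] := top_jump sC cC nC1 Cs.
have [|finD structD] := IH s' D _ sD cD Ds'.
  by rewrite -ltnS (leq_trans _ szs).
have [t Ct nDt] : exists2 t, C t & ~ D t.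
  by apply: contrapT => nt; apply: nCD => x Cx; apply: contrapT => nx; apply: nt; exists x.
suff cvx Q : rcone C [set 1] Q -> convex Q D.
  split; last by right; exists D.
  apply: (finite_rcone_ext sC sD subgroup1 DC (sub1_subgroup sD) cvx) => //.
  exact: (commensurable_finite sC sD DC ccCD Ct nDt).
move=> rQ; case: structD => [D1|[E [sE ED nDE DE ccDE] cvxE]].
  move=> x y Qx _ /D1 -> ; by rewrite mul1g.
have nD : normal_in C D := comm_mod_normal sD DC CD.
have rPD := rcone_down sD (@subsetT _ D) rP.
have nE := convex_normal sC sD sE DC ED nD ccDE nDE rPD cvxE.
have rQD := rcone_down sD DC rQ.
have rT := rcone_up sD subgroup1 sE (sub1_subgroup sE) ED rQD (cvxE _ rQD).
have [x0 Dx0 nEx0] : exists2 x, D x & ~ E x.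
  by apply: contrapT => nt; apply: nDE => x Dx; apply: contrapT => nx; apply: nt; exists x.
have [x1 Tx1] : exists x, ((Q `&` D) `\` E) x.
  by case: (rc3 rT Dx0) => // h; [exists x0|exists x0^-1].
apply: contrapT => ncvx.
have T_conj c x : C c -> ((Q `&` D) `\` E) x -> ((Q `&` D) `\` E) (c * x * c^-1).
  move=> Cc Tx; have Dcx := nD _ _ Cc (rcS rT Tx).
  case: (rc3 rT Dcx) => // [Ex|Tx'].
    case: (rcD rT Tx); have := nE _ _ (sgV sC Cc) Ex; by gsimp.
  case: ncvx; apply: (reversed_convex sC sD sE DC ED CD ccCD DE ccDE rQ (cvxE _ rQD) Cc Tx).
  by move: Tx'; gsimp.
apply: (positive_uncountable sC sD sE DC ED CD ccCD DE ccDE rT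
          (jump_rcone LP sC sD DC cD) nE T_conj Tx1 Ct nDt).
apply: (countable_rcone cLO LP sC sE (subset_trans ED DC) cC).
move=> x y Px nEx Ey; have [Dx|nDx] := pselect (D x).
  by have [] := cvxE _ rPD x y (conj Px Dx) nEx Ey.
by apply: cD => //; exact: ED.
Qed.

End Induction.
End Main.

Theorem corollary3p10 (G : groupType) :
  finite_set (LO G) \/ ~ countable (LO G).
Proof.
have [cLO|] := pselect (countable (LO G)); [left|by right].
have [->|LO0] := eqVneq (LO G) set0; first exact: finite_set0.
move/set0P in LO0.
have [P LP recP] := countable_LO_recurrent cLO LO0.
have [s hs] := (finite_seqP _).1 (finite_hulls LP cLO).
have eLO : LO G = [set T | rcone [set: G] [set 1] T].
  by apply/funext => T; apply/propext; exact: LO_rcone.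
rewrite eLO; have [||//] := convex_finite (s := s) cLO LP recP subgroupT.
  by move=> x y _ nx; case: nx.
move=> h _ nh1; suff : [set` s] (hull P h) by [].
by rewrite -hs; exists h.
Qed.
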